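(* Let $n\ge 2$, $m\ge 1$, and let $B_j=\mathbb{B}^n(x_j,r_j)$, $j=1,\dots,m$, be balls in $\mathbb{R}^n$ (with centers $x_j\in\mathbb{R}^n$ and radii $r_j>0$) such that $|r_{j+1}-r_j|<|x_{j+1}-x_j|<r_j+r_{j+1}$ for $1\le j<m$, and $\overline{B_j}\cap\overline{B_k}=\emptyset$ whenever $|j-k|>1$. Then $D=B_1\cup B_2\cup\dots\cup B_m$ is a quasiball.
   Context: $\mathbb{B}^n(x,r)=\{z\in\mathbb{R}^n:|z-x|<r\}$, $\mathbb{B}^n=\mathbb{B}^n(0,1)$, and $\overline{\mathbb{R}}^n=\mathbb{R}^n\cup\{\infty\}$ is the one-point compactification of $\mathbb{R}^n$. A continuous mapping $f\colon G\to\mathbb{R}^n$ of a domain $G\subset\mathbb{R}^n$, $n\ge 2$, is quasiregular if $f\in W^{1,n}_{\mathrm{loc}}(G)$ and there is $K\in[1,\infty)$ with $|f'(x)|^n\le K J_f(x)$ for a.e. $x\in G$, where $f'(x)$ is the formal derivative, $J_f$ its determinant, $|f'(x)|=\max_{|h|=1}|f'(x)h|$; the smallest such $K$ is $K_O(f)$. The smallest $K\ge1$ with $J_f(x)\le K\,l(f'(x))^n$ a.e., where $l(f'(x))=\min_{|h|=1}|f'(x)h|$, is $K_I(f)$. $f$ is $K$-quasiregular if $\max\{K_I(f),K_O(f)\}\le K$. A ($K$-)quasiregular homeomorphism $f\colon G\to fG$ is called ($K$-)quasiconformal. A homeomorphism $f$ of $\overline{\mathbb{R}}^n$ onto itself is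 $K$-quasiconformal if its restriction to $\mathbb{R}^n\setminus\{f^{-1}(\infty)\}$ is $K$-quasiconformal. A domain $G\subset\overline{\mathbb{R}}^n$ is a $K$-quasiball if there is a $K$-quasiconformal mapping $f$ of $\overline{\mathbb{R}}^n$ onto itself with $G=f(\mathbb{B}^n)$; it is a quasiball if it is a $K$-quasiball for some $K<\infty$. *)

(* Defs.v *)
From HB Require Import structures.
From mathcomp Require Import all_boot all_order all_algebra.
From mathcomp Require Import all_classical all_reals all_analysis.

Set Implicit Arguments.
Unset Strict Implicit.
Unset Printing Implicit Defensive.

Import Order.TTheory GRing.Theory Num.Theory.
Import numFieldNormedType.Exports.

Local Open Scope classical_set_scope.
Local Open Scope ring_scope.

Definition rV_display : measure_display -> measure_display.
Proof. exact. Qed.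

(* The sigma-algebra generated by the coordinates, i.e. the Borel one; this
   mirrors the library's instance on [n.-tuple]. *)
Section rV_measurable.
Context {R : realType} (n : nat).

Let coors : 'I_n -> 'rV[R]_n -> R := fun i x => x ord0 i.

Let rV_set0 : g_sigma_preimage coors set0.
Proof. exact: sigma_algebra0. Qed.

Let rV_setC A : g_sigma_preimage coors A -> g_sigma_preimage coors (~` A).
Proof. exact: sigma_algebraC. Qed.

Let rV_bigcup (F : (set 'rV[R]_n)^nat) :
  (forall i, g_sigma_preimage coors (F i)) ->
  g_sigma_preimage coors (\bigcup_i (F i)).
Proof. exact: sigma_algebra_bigcup. Qed.

HB.instance Definition _ :=
  @isMeasurable.Build (rV_display default_measure_display)
    'rV[R]_n (g_sigma_preimage coors) rV_set0 rV_setC rV_bigcup.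

Lemma measurable_rV_coord (i : 'I_n) :
  measurable_fun [set: 'rV[R]_n] (fun x : 'rV[R]_n => x ord0 i).
Proof.
move=> _ Y mY; rewrite setTI; apply: sub_sigma_algebra => /=.
rewrite -bigcup_seq/=; exists i => /=; first by rewrite mem_index_enum.
by exists Y => //; rewrite setTI.
Qed.

Lemma measurable_fun_rV d (T : measurableType d) (f : T -> 'rV[R]_n) :
  (forall i, measurable_fun [set: T] (fun t => f t ord0 i)) ->
  measurable_fun [set: T] f.
Proof.
move=> mf.
suff prefS : g_sigma_preimage (fun i => coors i \o f) `<=` measurable.
  move=> _ A mA; rewrite setTI; apply: prefS; rewrite g_sigma_preimage_comp.
  by exists A => //; rewrite setTI.
apply: smallest_sub; first exact: sigma_algebra_measurable.
elim/big_ind : _ => [|A B AS BS|i _]; first by [].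
- by move=> C [/AS|/BS].
- by move=> _ [B mB <-]; exact: mf.
Qed.

End rV_measurable.

Section lebesgue_rV.
Context {R : realType}.

Definition rV_cons n (p : measurableTypeR R * 'rV[R]_n) : 'rV[R]_n.+1 :=
  row_mx (const_mx p.1 : 'rV[R]_1) p.2.

Definition rV_uncons n (x : 'rV[R]_n.+1) : measurableTypeR R * 'rV[R]_n :=
  (x ord0 ord0, \row_i x ord0 (lift ord0 i)).

Lemma rV_unconsK n : cancel (@rV_uncons n) (@rV_cons n).
Proof.
move=> x; apply/rowP => i; rewrite /rV_cons /rV_uncons/= mxE.
case: splitP => /= j ij; rewrite !mxE; congr (x _ _); apply/val_inj => /=.
- by rewrite ij ord1.
- by rewrite ij.
Qed.

Lemma rV_consK n : cancel (@rV_cons n) (@rV_uncons n).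
Proof.
move=> [t x]; rewrite /rV_cons /rV_uncons/=; congr (_, _).
- rewrite mxE; case: splitP => //= j; first by rewrite mxE.
- apply/rowP => i; rewrite !mxE; case: splitP => /= j ij.
  + by have := ltn_ord j; rewrite -ij.
  + by congr (x _ _); apply/val_inj => /=; case: ij.
Qed.

Lemma measurable_rV_cons n : measurable_fun setT (@rV_cons n).
Proof.
apply: measurable_fun_rV => i; rewrite /rV_cons.
case: (splitP (i : 'I_(1 + n))) => j ij.
- rewrite (_ : (fun _ => _) = fst); first exact: measurable_fst.
  apply/funext => p; rewrite mxE; case: splitP => k ik; first by rewrite mxE.
  by have := ltn_ord j; rewrite -ij ik.
- rewrite (_ : (fun _ => _) = (fun x : 'rV[R]_n => x ord0 j) \o snd).
    by apply: measurableT_comp; [exact: measurable_rV_coord|exact: measurable_snd].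
  apply/funext => p; rewrite mxE; case: splitP => k ik.
    by have := ltn_ord k; rewrite -ik ij.
  by congr (p.2 _ _); apply/val_inj => /=; move: ij; rewrite ik => -[].
Qed.

Lemma measurable_rV_uncons n : measurable_fun setT (@rV_uncons n).
Proof.
apply/measurable_fun_pair; first exact: measurable_rV_coord.
apply: measurable_fun_rV => i.
rewrite (_ : (fun _ => _) = fun x : 'rV[R]_n.+1 => x ord0 (lift ord0 i)).
  exact: measurable_rV_coord.
by apply/funext => x; rewrite mxE.
Qed.

(* Sigma-finiteness is proved by hand because the library's canonical
   [SigmaFiniteMeasure] instance on [m1 \x m2] only covers products of
   subprobabilities. *)
Section lebesgue_rVS.
Context n (mu : {sigma_finite_measure set 'rV[R]_n -> \bar R}).

Definition lebesgue_rVS : set 'rV[R]_n.+1 -> \bar R :=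
  pushforward (lebesgue_measure \x mu)%E (@rV_cons n).

Let lebesgue_rVS0 : lebesgue_rVS set0 = 0%E.
Proof. by rewrite /lebesgue_rVS /pushforward preimage_set0 measure0. Qed.

Let lebesgue_rVS_ge0 A : (0 <= lebesgue_rVS A)%E.
Proof. by rewrite /lebesgue_rVS /pushforward; exact: measure_ge0. Qed.

Let lebesgue_rVS_sigma_additive : semi_sigma_additive lebesgue_rVS.
Proof.
have mf := @measurable_rV_cons n.
move=> F mF tF mUF; rewrite /lebesgue_rVS /pushforward preimage_bigcup.
apply: measure_semi_sigma_additive.
- by move=> k; rewrite -[X in measurable X]setTI; exact: mf.
- apply/trivIsetP => /= i j _ _ ij; rewrite -preimage_setI.
  by move/trivIsetP : tF => /(_ _ _ _ _ ij) ->//; rewrite preimage_set0.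
- by rewrite -preimage_bigcup -[X in measurable X]setTI; exact: mf.
Qed.

HB.instance Definition _ := isMeasure.Build _ _ _ lebesgue_rVS
  lebesgue_rVS0 lebesgue_rVS_ge0 lebesgue_rVS_sigma_additive.

Let lebesgue_rVS_sigma_finite : sigma_finite setT lebesgue_rVS.
Proof.
have /sigma_finiteP[F [UF ndF Foo]] := sigma_finiteT (@lebesgue_measure R).
have /sigma_finiteP[G [UG ndG Goo]] := sigma_finiteT mu.
exists (fun k => @rV_uncons n @^-1` (F k `*` G k)).
  apply/esym/seteqP; split=> // x _.
  have [k _ Fk] : (\bigcup_k F k) (rV_uncons x).1 by rewrite -UF.
  have [l _ Gl] : (\bigcup_k G k) (rV_uncons x).2 by rewrite -UG.
  exists (maxn k l) => //; split.
  - by move: (rV_uncons x).1 Fk; exact/subsetPset/ndF/leq_maxl.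
  - by move: (rV_uncons x).2 Gl; exact/subsetPset/ndG/leq_maxr.
move=> k; have [mFk Fk] := Foo k; have [mGk Gk] := Goo k; split.
  rewrite -[X in measurable X]setTI; apply: measurable_rV_uncons => //.
  exact: measurableX.
rewrite /lebesgue_rVS /pushforward -comp_preimage.
rewrite (_ : _ \o _ = id); last by apply/funext => p /=; rewrite rV_consK.
by rewrite preimage_id product_measure1E// lte_mul_pinfty// ge0_fin_numE.
Qed.

HB.instance Definition _ := Measure_isSigmaFinite.Build _ _ _ lebesgue_rVS
  lebesgue_rVS_sigma_finite.

End lebesgue_rVS.

(* Lebesgue measure on the Borel sets of R^n, as the n-fold product of the
   Lebesgue measure of R; it is not completed, but [{ae _, _}] and
   [negligible] do not need completeness. *)
Fixpoint lebesgue_rV n : {sigma_finite_measure set 'rV[R]_n -> \bar R} :=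
  match n with
  | 0 => \d_(0 : 'rV[R]_0)
  | n'.+1 => lebesgue_rVS (lebesgue_rV n')
  end.

End lebesgue_rV.

Section euclidean.
Context {R : realType} (n : nat).
Implicit Types (x v : 'rV[R]_n) (A : 'M[R]_n).

Definition enorm v : R := Num.sqrt (\sum_i v ord0 i ^+ 2).

Definition eball x (r : R) : set 'rV[R]_n := [set z | enorm (z - x) < r].

(* Matrices act on row vectors, [h |-> h *m A], as in the library's Jacobian
   ['J f p]; the supremum and the infimum are over a compact set, nonempty as
   soon as [0 < n]. *)
Definition opnorm A : R :=
  sup [set enorm (h *m A) | h in [set h | enorm h = 1]].

Definition min_stretch A : R :=
  inf [set enorm (h *m A) | h in [set h | enorm h = 1]].

End euclidean.

Section sobolev.
Context {R : realType} (n : nat).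
Implicit Types (G : set 'rV[R]_n) (phi u g : 'rV[R]_n -> R).

Local Notation mu := (lebesgue_rV n).

Definition partial (i : 'I_n) phi : 'rV[R]_n -> R := 'D_(delta_mx 0 i) phi.

(* [phi] is C^oo: all iterated partial derivatives exist and are continuous. *)
Definition smooth phi := forall s : seq 'I_n,
  continuous (foldr partial phi s) /\
  forall i x, derivable (foldr partial phi s) x (delta_mx 0 i).

Definition test_function G phi :=
  [/\ smooth phi, compact (closure [set x | phi x != 0])
    & closure [set x | phi x != 0] `<=` G].

Definition Lp_loc (p : nat) G u := measurable_fun G u /\
  forall C, compact C -> C `<=` G ->
    mu.-integrable C (fun x => (`|u x| ^+ p)%:E).

Definition weak_partial G (i : 'I_n) u g := forall phi, test_function G phi ->
  \int[mu]_(x in G) (u x * partial i phi x) =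
  - \int[mu]_(x in G) (g x * phi x).

(* [f] is in W^{1,p}_loc(G) with formal derivative [Df]. Following the
   convention of ['J], the entry (i, j) of [Df x] is the i-th weak partial
   derivative of the j-th component of [f]. As measurability is Borel, [Df] is
   a Borel representative of its a.e. class. *)
Definition sobolev_loc (p : nat) G (f : 'rV[R]_n -> 'rV[R]_n)
    (Df : 'rV[R]_n -> 'M[R]_n) :=
  (forall j, Lp_loc p G (fun x => f x ord0 j)) /\
  (forall i j, Lp_loc p G (fun x => Df x i j) /\
    weak_partial G i (fun x => f x ord0 j) (fun x => Df x i j)).

End sobolev.

Definition domain {T : topologicalType} (G : set T) :=
  [/\ open G, connected G & G !=set0].

(* [f] restricts to a homeomorphism of [G] onto its image. *)
Definition homeomorphism_on {T U : topologicalType} (G : set T) (f : T -> U) :=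
  {within G, continuous f} /\
  exists g : U -> T,
    {within f @` G, continuous g} /\ {in G, cancel f g}.

Section quasiconformal.
Context {R : realType} (n : nat).
Implicit Types (G : set 'rV[R]_n) (f : 'rV[R]_n -> 'rV[R]_n).
Implicit Types (Df : 'rV[R]_n -> 'M[R]_n) (K : R).

Local Notation mu := (lebesgue_rV n).

Definition outer_bound G Df K :=
  {ae mu, forall x, G x -> opnorm (Df x) ^+ n <= K * \det (Df x)}.

Definition inner_bound G Df K :=
  {ae mu, forall x, G x -> \det (Df x) <= K * min_stretch (Df x) ^+ n}.

Definition quasiregular G f :=
  [/\ domain G, {within G, continuous f}
    & exists2 Df, sobolev_loc n G f Df
      & exists2 K, 1 <= K & outer_bound G Df K].

(* The formal derivative is unique up to a null set, so the choice of [Df] is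
   immaterial. The infimum is attained when the set is not empty and is [+oo]
   when it is empty. *)
Definition K_outer G f : \bar R := ereal_inf [set K%:E | K in
  [set K | 1 <= K /\ exists2 Df, sobolev_loc n G f Df & outer_bound G Df K]].

Definition K_inner G f : \bar R := ereal_inf [set K%:E | K in
  [set K | 1 <= K /\ exists2 Df, sobolev_loc n G f Df & inner_bound G Df K]].

Definition Kquasiregular K G f :=
  quasiregular G f /\ (maxe (K_inner G f) (K_outer G f) <= K%:E)%E.

Definition Kquasiconformal K G f :=
  Kquasiregular K G f /\ homeomorphism_on G f.

Local Notation Rbar := (one_point_compactification 'rV[R]_n).

(* The value 0 is irrelevant: [finite_part f] is only considered on the
   complement of the preimage of infinity. *)
Definition finite_part (f : Rbar -> Rbar) : 'rV[R]_n -> 'rV[R]_n :=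
  fun x => if f (Some x) is Some y then y else 0.

Definition Kquasiconformal_Rbar K (f : Rbar -> Rbar) :=
  [/\ continuous f,
      (exists g : Rbar -> Rbar, [/\ continuous g, cancel f g & cancel g f])
    & Kquasiconformal K [set x | f (Some x) <> None] (finite_part f)].

Definition Kquasiball K (D : set Rbar) := domain D /\
  exists2 f, Kquasiconformal_Rbar K f & D = f @` (Some @` eball 0 1).

Definition quasiball (D : set Rbar) := exists K, Kquasiball K D.

End quasiconformal.

(* Main.v *)
(* It suffices to find a bi-Lipschitz homeomorphism of R^n, differentiable with
   positive Jacobian off a null set, which maps the unit ball onto D: extended
   by fixing infinity it is quasiconformal.  Lipschitz maps are in W^{1,n}_loc,
   the weak derivative being the a.e. limit of difference quotients (dominated
   convergence and translation invariance of Lebesgue measure).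

   The map is a composition of maps attaching one ball B = B_{k+1} to the
   previous ball A = B_k while fixing B_1, ..., B_{k-1}.  Put the origin at the
   centre of the sphere where the boundaries of A and B meet and let a, b be the
   Minkowski gauges of A and B.  Multiplying z by a stretching factor which is
   max(1, a/b) inside A, decreases along each ray outside A, and is 1 as soon as
   (1 - d) b(z) >= 1, takes A onto the union of A and B and moves only points of
   a slight dilate of B, which does not meet the earlier balls if d is small.
   With this origin the cone a = b is a hyperplane, and the map is smooth off
   this hyperplane and two hypersurfaces that meet each ray at most once; these
   are Lipschitz images of subsets of hyperplanes, and so are their images under
   the other maps of the composition. *)

From HB Require Import structures.
Require Import Defs.
From mathcomp Require Import all_boot all_order all_algebra.
From mathcomp Require Import all_classical all_reals all_analysis.
From mathcomp Require Import lra ring perm measurable_realfun.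
Import Order.TTheory GRing.Theory Num.Theory.
Import numFieldNormedType.Exports.
Local Open Scope classical_set_scope.
Local Open Scope ring_scope.
Set Implicit Arguments.
Unset Strict Implicit.
Unset Printing Implicit Defensive.

(** * Borel sets and Lebesgue measure of R^n *)

(** The Jacobian of a radial map z -> s(z) z is s^(n-1) (s + D_z s), and s + D_z s is its slope
    along the ray through z, so its sign is decided ray by ray. In the parameter a(z) the stretching
    is piecewise linear on each ray, with slope k = max(1, a/b) up to a = 1, then d until the
    identity is met, then 1: all slopes are positive and the inverse is equally explicit. The
    obstacle is the origin: k is homogeneous of degree 0, in general discontinuous there, so the
    factor s is not Lipschitz. What survives is boundedness of s and a bound of |u| |s(u) - s(v)| by
    a multiple of |u - v|. This is stable under sums, products and maxima, and it suffices for s(z)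
    z. The chosen origin has the same power with respect to both spheres. The power is negative
    because the spheres cross, and a scaling makes it -1. A ball of centre c then has the gauge
    sqrt((c.z)^2 + |z|^2) - c.z, which for fixed nonzero z decreases strictly in c.z; hence
    comparing a with b amounts to reading the sign of (c_B - c_A).z. *)

Section row_vector_norm.
Context {R : realType} (n : nat).
Implicit Types (u v w : 'rV[R]_n).

Lemma coord_le_norm v i : `|v ord0 i| <= `|v|.
Proof.
rewrite [leRHS]/Num.norm/= mx_normrE; apply/bigmax_geP; right => /=.
by exists (ord0, i).
Qed.

Lemma norm_le_coord v (r : R) : 0 <= r ->
  (forall i, `|v ord0 i| <= r) -> `|v| <= r.
Proof.
move=> r0 vr; rewrite [leLHS]/Num.norm/= mx_normrE.
by apply/bigmax_leP; split=> //= -[i j] _ /=; rewrite ord1.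
Qed.

End row_vector_norm.

(** No sign is imposed on [L], so proofs that need a nonnegative constant pass to its absolute
    value. On row vectors the norm is the sup norm. *)
Definition lipschitz_with {R : realType} {V W : normedModType R} (L : R)
  (A : set V) (f : V -> W) :=
  forall x y, A x -> A y -> `|f x - f y| <= L * `|x - y|.

Lemma lipschitz_with_continuous {R : realType} (V W : normedModType R) (L : R)
  (f : V -> W) : lipschitz_with L setT f -> continuous f.
Proof.
move=> fL x; apply/cvgrPdist_le => e e0; near=> y.
have L1 : 0 < `|L| + 1 by rewrite ltr_wpDl.
rewrite (le_trans (fL _ _ I I))//.
rewrite (@le_trans _ _ ((`|L| + 1) * `|x - y|))//.
  by rewrite ler_wpM2r// (le_trans (ler_norm _))// lerDl.
rewrite mulrC -ler_pdivlMr//; near: y; apply: cvgr_dist_le; first exact: cvg_id.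
by rewrite divr_gt0.
Unshelve. all: by end_near. Qed.


Section lebesgue_rV_theory.
Context {R : realType}.

(** The sigma-algebra is only known to be generated by the coordinates, so [U] is exhibited as the
    countable union of the boxes with rational centre and radius 1/(k+1) that it contains. *)
Lemma open_measurable_rV n (U : set 'rV[R]_n) : open U -> measurable U.
Proof.
move=> oU.
pose box (q : 'rV[rat]_n) (k : nat) : set 'rV[R]_n :=
  \bigcap_(i in [set: 'I_n]) [set x | `|x ord0 i - ratr (q ord0 i)| < k.+1%:R^-1].
have mbox q k : measurable (box q k).
  apply: fin_bigcap_measurable => // i _.
  rewrite [X in measurable X](_ : _ = setT `&` (fun x : 'rV[R]_n => x ord0 i) @^-1`
    ball (ratr (q ord0 i) : R) k.+1%:R^-1).
    by apply: measurable_rV_coord => //; apply: open_measurable; exact: ball_open.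
  by rewrite setTI; apply/seteqP; split => x /=; rewrite /ball/= distrC.
have -> : U = \bigcup_(p : 'rV[rat]_n * nat)
    (if `[< box p.1 p.2 `<=` U >] then box p.1 p.2 else set0).
  apply/seteqP; split => [x Ux|x [p _]]; last first.
    by case: asboolP => // + bx; apply.
  have /nbhs_ballP[e /= e0 xU] : nbhs x U by exact: open_nbhs_nbhs.
  have [k ke] : exists k : nat, k.+1%:R^-1 < e / 2.
    have [k _ ke] := @near_infty_natSinv_lt R (PosNum (divr_gt0 e0 (ltr0n _ 2))).
    by exists k; apply: ke => /=.
  have /choice[q xq] : forall i : 'I_n, exists q : rat,
      `|x ord0 i - ratr q| < k.+1%:R^-1.
    move=> i; have k0 : (0 : R) < k.+1%:R^-1 by rewrite invr_gt0.
    have [q] := @rat_in_itvoo R (x ord0 i) (x ord0 i + k.+1%:R^-1)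
      (ltr_pwDr k0 (lexx _)).
    rewrite in_itv/= => /andP[q1 q2]; exists q.
    by rewrite distrC ltr_norml ltrBlDl q2 ltrBrDl (lt_trans _ q1)// gtrBl.
  exists (\row_i q i, k) => //=.
  case: asboolP => [|[]]; first by move=> _ i _ /=; rewrite mxE.
  move=> y yb; apply: xU; rewrite mx_norm_ball /ball_ /=.
  apply: (@le_lt_trans _ _ (k.+1%:R^-1 + k.+1%:R^-1)); last first.
    by rewrite [ltRHS]splitr ltrD.
  apply: norm_le_coord => [|i]; first by rewrite addr_ge0.
  rewrite !mxE (le_trans (ler_distD (ratr (q i)) _ _))// lerD ?ltW//.
  by have := yb i I; rewrite /= mxE distrC.
apply: countable_bigcupT_measurable; first exact: countableP.
by move=> p; case: ifP => _ //; exact: mbox.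
Qed.

Lemma closed_measurable_rV n (A : set 'rV[R]_n) : closed A -> measurable A.
Proof.
move=> cA; rewrite -(setCK A); apply: measurableC; apply: open_measurable_rV.
exact: closed_openC.
Qed.

Lemma continuous_measurable_rV n (f : 'rV[R]_n -> R) :
  continuous f -> measurable_fun setT f.
Proof.
move=> cf; apply: (measurability _ (RGenOpens.measurableE R)) => //.
move=> _ [_ [A [oA ->]] <-]; rewrite setTI; apply: open_measurable_rV.
by move/continuousP : cf; exact.
Qed.

Lemma measurable_rV_shift n (v : 'rV[R]_n) :
  measurable_fun setT (fun x : 'rV[R]_n => x + v).
Proof.
apply: measurable_fun_rV => i; under eq_fun do rewrite mxE.
by apply: measurable_funD => //; exact: measurable_rV_coord.
Qed.

(** The pushforward by the translation has the right value on intervals, and these determine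
    Lebesgue measure. *)
Lemma lebesgue_measure_shift (t : R) (A : set (measurableTypeR R)) :
  measurable A -> lebesgue_measure ((fun x => x + t) @^-1` A) = lebesgue_measure A.
Proof.
move=> mA.
pose f (x : measurableTypeR R) : measurableTypeR R := x + t.
have mf : measurable_fun setT f by exact: measurable_funD.
pose g : {mfun measurableTypeR R >-> measurableTypeR R} :=
  HB.pack f (isMeasurableFun.Build _ _ _ _ f mf).
apply/esym; apply: (@lebesgue_measure_unique R
  (pushforward lebesgue_measure g)) => //.
move=> _ [[a b]] _ <-; rewrite /pushforward /=.
rewrite [RHS](_ : _ = lebesgue_measure `]a - t, b - t]%classic); last first.
  by congr lebesgue_measure; apply/seteqP; split=> x /=;
    rewrite /f !in_itv/= => /andP[? ?]; apply/andP; split; lra.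
by rewrite !lebesgue_measure_itv/= !lte_fin ltrD2r; case: ifP => // _;
  congr (_%:E); lra.
Qed.

Lemma rV_consD n (t : R) (x : 'rV[R]_n) (v : 'rV[R]_n.+1) :
  rV_cons (t, x) + v =
  rV_cons (t + (rV_uncons v).1 : measurableTypeR R, x + (rV_uncons v).2).
Proof.
apply/rowP => i; rewrite /rV_cons/= !mxE.
case: (splitP (i : 'I_(1 + n))) => j ij; rewrite !mxE//.
  by congr (_ + v _ _); apply/val_inj; rewrite /= ij ord1.
by congr (_ + v _ _); apply/val_inj.
Qed.

(** Induction on [n]: the section at t of the translated set is a translate of the section of [A] at
    t + v_0, and the remaining integral over t is invariant under translations of the line. *)
Lemma lebesgue_rV_shift n (v : 'rV[R]_n) (A : set 'rV[R]_n) :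
  measurable A -> lebesgue_rV n ((fun x => x + v) @^-1` A) = lebesgue_rV n A.
Proof.
elim: n v A => [|n IH] v A mA.
  congr (lebesgue_rV 0 _); apply/seteqP; split=> x /=.
    by rewrite [x + v]thinmx0 [x]thinmx0.
  by rewrite [x + v]thinmx0 [x]thinmx0.
have mAv : measurable ((fun x => x + v) @^-1` A).
  by rewrite -[X in measurable X]setTI; exact: measurable_rV_shift.
rewrite /= /lebesgue_rVS /pushforward /product_measure1.
have mcA B : measurable B -> measurable (@rV_cons R n @^-1` B).
  by move=> mB; rewrite -[X in measurable X]setTI; exact: measurable_rV_cons.
pose p := rV_uncons v.
pose f (t : measurableTypeR R) : measurableTypeR R := (t : R) + p.1.
pose h (t : measurableTypeR R) : \bar R :=
  lebesgue_rV n (xsection (@rV_cons R n @^-1` A) t).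
transitivity (\int[@lebesgue_measure R]_t (h \o f) t)%E.
  apply: eq_integral => t _ /=; rewrite /h /f -[RHS](IH p.2); last first.
    by apply: measurable_xsection; exact: mcA.
  congr (lebesgue_rV n _); apply/seteqP; split => x /=;
    by rewrite /xsection/= !inE/= rV_consD.
have mh : measurable_fun setT h.
  apply: (@measurable_fun_xsection _ _ _ _ R (lebesgue_rV n)); exact: mcA.
have mf : measurable_fun setT f.
  exact: measurable_funD.
rewrite -(@ge0_integral_pushforward _ _ _ _ R _ mf lebesgue_measure setT h)//.
apply: eq_measure_integral => B mB _; exact: lebesgue_measure_shift.
Qed.

Lemma measurable_rV_cube n (q : 'rV[R]_n) (r : R) :
  measurable [set x : 'rV[R]_n | `|x - q| <= r].
Proof.
apply: closed_measurable_rV.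
have cf : continuous (fun x : 'rV[R]_n => `|x - q|).
  apply: (@lipschitz_with_continuous _ 'rV[R]_n R^o 1) => x y _ _; rewrite mul1r.
  by rewrite (le_trans (ler_dist_dist _ _))// opprB addrA subrK.
by move/continuous_closedP : cf => /(_ _ (@closed_le R r)); exact.
Qed.

Lemma lebesgue_rV_cube n (q : 'rV[R]_n) (r : R) : 0 <= r ->
  (lebesgue_rV n [set x | `|x - q| <= r]%R <= ((2 * r) ^+ n)%:E)%E.
Proof.
move=> r0; elim: n q => [|n IH] q.
  by rewrite /= diracE expr0 lee_fin lern1 leq_b1.
pose q' := (rV_uncons q).2.
pose I : set (measurableTypeR R) := `[q ord0 ord0 - r, q ord0 ord0 + r]%classic.
pose C : set 'rV[R]_n := [set x | `|x - q'| <= r].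
have mI : measurable I by exact: measurable_itv.
have mC : measurable C by exact: measurable_rV_cube.
apply: (@le_trans _ _ ((lebesgue_measure \x lebesgue_rV n) (I `*` C))%E).
  rewrite /= /lebesgue_rVS /pushforward; apply: le_measure; rewrite ?inE.
  - rewrite -[X in measurable X]setTI; apply: measurable_rV_cons => //.
    exact: measurable_rV_cube.
  - exact: measurableX.
  - move=> [t x] /= txq.
    have h (i : 'I_n.+1) : `|(rV_cons (t, x) - q) ord0 i| <= r.
      exact: le_trans (coord_le_norm _ _) txq.
    split => /=.
      have := h ord0; rewrite !mxE; case: splitP => //= j _; rewrite mxE/=.
      by rewrite /I/= in_itv/= ler_norml => /andP[? ?]; apply/andP; split; lra.
    apply: norm_le_coord => // i; have := h (lift ord0 i); rewrite !mxE.
    case: splitP => /= j; first by move=> e; have := ltn_ord j; rewrite -e.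
    by case=> ij; rewrite (_ : j = i)//; apply/val_inj.
rewrite product_measure1E// exprS EFinM lee_pmul//; last exact: IH.
rewrite -[leLHS]/(lebesgue_measure I) lebesgue_measure_itv.
rewrite /= lte_fin; case: ifP => _; last by rewrite lee_fin mulr_ge0.
by rewrite -EFinB lee_fin; lra.
Qed.


End lebesgue_rV_theory.

Definition dot {R : realType} n (u v : 'rV[R]_n) : R :=
  \sum_i u ord0 i * v ord0 i.

(** * Lipschitz images of hyperplanes are null *)

Section hyperplane_image.
Context {R : realType}.

Lemma fin_bigcup_measure_le d (T : measurableType d)
    (mu : {measure set T -> \bar R}) (I : finType) (F : I -> set T) (b : R) :
  (forall i, measurable (F i)) -> (forall i, mu (F i) <= b%:E)%E ->
  (mu (\bigcup_i F i) <= (#|I|%:R * b)%:E)%E.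
Proof.
move=> mF Fb.
have -> : \bigcup_i F i = \big[setU/set0]_(i <- enum I) F i.
  rewrite -bigcup_seq; apply/seteqP; split => [x [i _ Fi]|x [i _ Fi]].
    by exists i => //=; rewrite mem_enum.
  by exists i.
rewrite cardE; elim: (enum I) => [|i s IH].
  by rewrite big_nil measure0 mul0r.
rewrite big_cons /= -nat1r mulrDl mul1r EFinD.
apply: le_trans (leeD (Fb i) IH); apply: measureU2 => //.
exact: bigsetU_measurable.
Qed.

(** Because [w ord0 i] is not 0, the equation of the hyperplane expresses coordinate [i] as a
    Lipschitz function of the others. *)
Lemma hyperplane_dist n (w x y : 'rV[R]_n.+1) (c e : R) (i : 'I_n.+1) :
  w ord0 i != 0 -> dot w x = c -> dot w y = c -> 0 <= e ->
  (forall j, `|x ord0 (lift i j) - y ord0 (lift i j)| <= e) ->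
  `|x - y| <= (1 + (\sum_j `|w ord0 j|) / `|w ord0 i|) * e.
Proof.
move=> wi wx wy e0 xy; have wi0 : 0 < `|w ord0 i| by rewrite normr_gt0.
have S0 : 0 <= \sum_j `|w ord0 j| by apply: sumr_ge0.
apply: norm_le_coord => [|k]; first by rewrite mulr_ge0// addr_ge0// divr_ge0// ltW.
rewrite !mxE; have [j ->|->] := unliftP i k.
  by rewrite (le_trans (xy j))// ler_peMl// lerDl divr_ge0// ltW.
rewrite mulrDl mul1r (@le_trans _ _ ((\sum_j `|w ord0 j|) / `|w ord0 i| * e))//;
  last first.
  by rewrite lerDr.
rewrite mulrAC ler_pdivlMr// -normrM.
have -> : (x ord0 i - y ord0 i) * w ord0 i =
    - \sum_j w ord0 (lift i j) * (x ord0 (lift i j) - y ord0 (lift i j)).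
  have : dot w x - dot w y = 0 by rewrite wx wy subrr.
  rewrite /dot -sumrB (bigD1_ord i)//= -mulrBr => /eqP.
  rewrite addr_eq0 mulrC => /eqP ->; congr (- _).
  by apply: eq_bigr => j _; rewrite -mulrBr.
rewrite normrN (le_trans (ler_norm_sum _ _ _))// mulr_suml [leRHS](bigD1_ord i)//=.
rewrite ler_wpDl//; first by rewrite mulr_ge0.
by apply: ler_sum => j _; rewrite normrM ler_wpM2l.
Qed.

(** A counting argument: in dimension n+1, a bounded piece of the hyperplane splits into O(k^n)
    cells of size O(1/k), whose images lie in cubes of measure O(1/k^(n+1)), so the total is
    O(1/k). *)
Lemma hyperplane_lipschitz_negligible n (w : 'rV[R]_n) (c L : R)
    (E : set 'rV[R]_n) (f : 'rV[R]_n -> 'rV[R]_n) :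
  w != 0 -> (forall x, E x -> dot w x = c) -> lipschitz_with L E f ->
  (lebesgue_rV n).-negligible (f @` E).
Proof.
case: n w E f => [|n] w E f; first by rewrite [w]thinmx0 eqxx.
move=> /rV0Pn[i wi] Ew fL; set mu := lebesgue_rV n.+1.
pose C := 1 + (\sum_j `|w ord0 j|) / `|w ord0 i|.
have C0 : 0 <= C by rewrite addr_ge0// divr_ge0// sumr_ge0.
pose EK (K : nat) := E `&` [set x | `|x| <= K%:R].
suff nK K : mu.-negligible (f @` EK K).
  apply: (@negligibleS _ _ _ _ (\bigcup_K f @` EK K)); last first.
    by apply: negligible_bigcup => K; exact: nK.
  move=> _ [x Ex <-]; have [K xK] : exists K : nat, `|x| <= K%:R.
    by exists (Num.truncn `|x|).+1; rewrite ltW// truncnS_gt.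
  by exists K => //; exists x.
(* The cell index is the integer part of a number in the closed interval [0, 2K(k+1)]; it can equal
   the right end, hence the successor. *)
pose M (k : nat) := (2 * K * k.+1).+1.
pose cell k (a : {ffun 'I_n -> 'I_(M k)}) := EK K `&` [set x |
  forall j, (a j)%:R <= (x ord0 (lift i j) + K%:R) * k.+1%:R <= (a j).+1%:R].
pose r (k : nat) : R := `|L| * C / k.+1%:R.
have r0 k : 0 <= r k by rewrite divr_ge0// mulr_ge0.
(* The image of a cell need not be measurable; a closed cube about the image of one chosen point of
   the cell contains it and is. *)
pose U k a := if pselect (cell k a !=set0) is left h then
  [set y | `|y - f (projT1 (cid h))| <= r k] else set0.
have mU k a : measurable (U k a).
  by rewrite /U; case: pselect => // h; exact: measurable_rV_cube.
have fU k : f @` EK K `<=` \bigcup_a U k a.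
  move=> _ [x EKx <-].
  have xK j : 0 <= (x ord0 (lift i j) + K%:R) * k.+1%:R <= (2 * K * k.+1)%:R.
    have : `|x ord0 (lift i j)| <= K%:R.
      by rewrite (le_trans (coord_le_norm _ _))//; exact: EKx.2.
    rewrite ler_norml => /andP[x1 x2].
    rewrite mulr_ge0//=; last by lra.
    by rewrite !natrM ler_wpM2r//; lra.
  have aM j : (Num.truncn ((x ord0 (lift i j) + K%:R) * k.+1%:R) < M k)%N.
    have /andP[h0 h1] := xK j; rewrite ltnS -(ler_nat R).
    by rewrite (le_trans _ h1)// truncn_le.
  pose a := [ffun j => Ordinal (aM j)].
  have cx : cell k a x.
    split=> // j; rewrite ffunE/=; have /andP[h0 h1] := xK j.
    by rewrite truncn_le h0 ltW// truncnS_gt.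
  exists a => //; rewrite /U; case: pselect => [h|[]]; last by exists x.
  case: (cid h) => q /= [[Eq _] qa]; rewrite (le_trans (fL _ _ EKx.1 Eq))//.
  rewrite (@le_trans _ _ (`|L| * `|x - q|))//;
    first by rewrite ler_wpM2r// ler_norm.
  rewrite /r -mulrA ler_wpM2l//;
    apply: (hyperplane_dist wi (Ew _ EKx.1) (Ew _ Eq)) => //.
  move=> j; have /andP[q1 q2] := qa j; have /andP[x1 x2] := cx.2 j.
  have k0 : 0 < k.+1%:R :> R by [].
  rewrite -[X in _ <= X]mul1r ler_pdivlMr// -(gtr0_norm k0) -normrM ler_norml.
  by rewrite mulrBl; move: q1 q2 x1 x2; rewrite -!natr1 !mulrDl; lra.
have mUk k : measurable (\bigcup_a U k a) by exact: fin_bigcup_measurable.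
exists (\bigcap_k \bigcup_a U k a); split.
- exact: bigcapT_measurable.
(* There are at most ((2K+1)(k+1))^n cells and each cube has side 2|L|C/(k+1), so their total
   measure is at most B/(k+1). *)
- pose B : R := (2 * K + 1)%:R ^+ n * (2 * (`|L| * C)) ^+ n.+1.
  have B0 : 0 <= B by rewrite mulr_ge0// exprn_ge0// mulr_ge0// mulr_ge0.
  have le k : (mu (\bigcap_k \bigcup_a U k a) <= (B / k.+1%:R)%:E)%E.
    apply: (@le_trans _ _ (mu (\bigcup_a U k a))).
      by apply: le_measure; rewrite ?inE//;
        [exact: bigcapT_measurable|exact: bigcap_inf].
    apply: le_trans (fin_bigcup_measure_le (mU k) (b := (2 * r k) ^+ n.+1) _) _.
      move=> a; rewrite /U; case: pselect => h; first exact: lebesgue_rV_cube.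
      by rewrite measure0 lee_fin exprn_ge0// mulr_ge0.
    rewrite lee_fin card_ffun !card_ord /B /r natrX.
    have t0 : 0 < k.+1%:R :> R by [].
    have Mle : (M k)%:R <= (2 * K + 1)%:R * k.+1%:R :> R.
      by rewrite -natrM ler_nat /M mulnDl mul1n -addn1 leq_add2l.
    rewrite [2 * (_ / _)]mulrA expr_div_n.
    rewrite (@le_trans _ _ (((2 * K + 1)%:R * k.+1%:R) ^+ n *
        ((2 * (`|L| * C)) ^+ n.+1 / k.+1%:R ^+ n.+1)))//.
      rewrite ler_wpM2r//; last by rewrite lerXn2r// ?nnegrE// mulr_ge0.
      by rewrite divr_ge0// exprn_ge0// mulr_ge0// mulr_ge0.
    rewrite le_eqVlt; apply/orP; left; apply/eqP.
    rewrite exprMn [k.+1%:R ^+ n.+1]exprS invfM.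
    have : k.+1%:R ^+ n != 0 :> R by rewrite expf_neq0// gt_eqF.
    have : k.+1%:R != 0 :> R by rewrite gt_eqF.
    move: (k.+1%:R : R) ((2 * (`|L| * C)) ^+ n.+1) => t X t1 tn.
    by field; rewrite t1 tn.
  apply/eqP; rewrite eq_le measure_ge0 andbT; apply/lee_addgt0Pr => e e0;
    rewrite add0e.
  have [k ke] : exists k : nat, B / k.+1%:R <= e.
    exists (Num.truncn (B / e)); rewrite ler_pdivrMr// mulrC -ler_pdivrMr//.
    by rewrite ltW// truncnS_gt.
  by apply: le_trans (le k) _; rewrite lee_fin.
- by move=> x fx k _; exact: fU.
Qed.

End hyperplane_image.

(** * Weak derivatives of Lipschitz maps *)

Definition diff_quot {R : realType} n (v : 'rV[R]_n) (u : 'rV[R]_n -> R)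
  (a : R) (x : 'rV[R]_n) : R := a^-1 * (u (a *: v + x) - u x).

Lemma addl_continuous {R : realType} n (w : 'rV[R]_n) :
  continuous (fun x : 'rV[R]_n => w + x).
Proof.
apply: (@lipschitz_with_continuous _ 'rV[R]_n 'rV[R]_n 1) => x y _ _.
by rewrite mul1r opprD addrACA subrr add0r.
Qed.

Section weak_derivative.
Context {R : realType} (n : nat).
Implicit Types (u phi f : 'rV[R]_n -> R) (v x : 'rV[R]_n).
Local Notation mu := (lebesgue_rV n).

Lemma continuous_diff_quot v u a : continuous u -> continuous (diff_quot v u a).
Proof.
move=> cu x.
have cuv : {for x, continuous (fun y : 'rV[R]_n => u (a *: v + y))}.
  exact: (@continuous_comp 'rV[R]_n 'rV[R]_n R _ u x (@addl_continuous R n (a *: v)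
    x) (cu _)).
have h1 : {for x, continuous ((fun y : 'rV[R]_n => u (a *: v + y)) - u)}.
  exact: (@continuousB _ R^o _ _ _ x cuv (cu x)).
by have c12 := continuousM (@cst_continuous 'rV[R]_n R a^-1 x) h1; exact: c12.
Qed.

Lemma diff_quot_cvg u v x (a : R^nat) : derivable u x v ->
  a @ \oo --> (0 : R) -> (forall k, a k != 0) ->
  diff_quot v u (a k) x @[k --> \oo] --> 'D_v u x.
Proof.
move=> dux a0 an0.
have /cvgr_dnbhsP/(_ a) := dux; apply; split => // k.
Qed.

Lemma lipschitz_diff_quot_le u v x (L a : R) : lipschitz_with L setT u ->
  a != 0 -> `|diff_quot v u a x| <= `|L| * `|v|.
Proof.
move=> uL a0; rewrite /diff_quot normrM normrV ?unitfE//
  mulrC ler_pdivrMr ?normr_gt0//.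
rewrite (le_trans (uL _ _ I I))// addrK normrZ mulrA mulrAC.
by rewrite ler_wpM2r// ler_wpM2r// ler_norm.
Qed.

Lemma derivable_diff_quot_le phi v x (M a : R) : 0 < a ->
  (forall t, 0 <= t <= a -> derivable phi (t *: v + x) v) ->
  (forall t, 0 <= t <= a -> `|'D_v phi (t *: v + x)| <= M) ->
  `|diff_quot v phi a x| <= M.
Proof.
move=> a0 dphi Mphi.
pose g (t : R) := phi (t *: v + x).
have dg t : 0 <= t <= a -> is_derive t 1 g ('D_v phi (t *: v + x)).
  move=> ta; have := dphi t ta => /[dup] dpt.
  have e : (fun h => h^-1 *: ((phi \o shift (t *: v + x)) (h *: v) - phi (t *: v +
    x))) =
           (fun h => h^-1 *: ((g \o shift t) (h *: (1 : R)) - g t)).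
    apply/funext => h /=; rewrite /g; congr (_ *: (phi _ - _)).
    by rewrite addrA -scalerDl /shift/= [h *: 1]mulr1.
  by move=> _; split; [rewrite /derivable -e|rewrite /derive -e].
have -> : diff_quot v phi a x = a^-1 * (g a - g 0).
  by rewrite /g /diff_quot scale0r add0r.
have [c cI ->] : exists2 c, c \in `[0, a]%R & g a - g 0 = 'D_v phi (c *: v + x) *
  (a - 0).
  apply: (@MVT_segment R g (fun t => 'D_v phi (t *: v + x))); first exact: ltW.
    by move=> t /[!in_itv]/= /andP[? ?]; apply: dg; rewrite !ltW.
  apply: derivable_within_continuous => t /[!in_itv]/= ta.
  exact: (@ex_derive _ _ _ _ _ _ _ (dg t ta)).
move: cI; rewrite in_itv/= => ca.
by rewrite subr0 mulrCA mulVf ?gt_eqF// mulr1 Mphi.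
Qed.

Lemma integrable_compact_support f (M K : R) : measurable_fun setT f ->
  (forall x, `|x| <= K -> `|f x| <= M) -> (forall x, K < `|x| -> f x = 0) ->
  mu.-integrable setT (EFin \o f).
Proof.
move=> mf fM f0; pose C : set 'rV[R]_n := [set x | `|x| <= K].
have CE : C = [set x | `|x - 0| <= K] by apply/seteqP; split => x;
  rewrite /C/= subr0.
have mC : measurable C by rewrite CE; exact: measurable_rV_cube.
have -> : EFin \o f = (EFin \o f) \_ C.
  apply/funext => x; rewrite patchE; case: ifPn => //;
    rewrite notin_setE /C/= => /negP.
  by rewrite -ltNge => /f0 ->.
apply/(integrable_mkcond _ mC); apply: measurable_bounded_integrable => //.
- have [K0|K0] := leP 0 K.
    by rewrite CE (le_lt_trans (lebesgue_rV_cube _ K0))// ltry.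
  rewrite (_ : C = set0) ?measure0//.
  by apply/seteqP; split => // x; rewrite /C/= leNgt (lt_le_trans K0).
- exact: measurable_funS mf.
- exists M; split; rewrite ?num_real // => N MN x Cx /=.
  by rewrite (le_trans (fM x Cx))// ltW.
Qed.

Lemma integrable_shift f v : mu.-integrable setT (EFin \o f) ->
  mu.-integrable setT (EFin \o (fun x => f (x + v))).
Proof.
move=> intf; pose s (x : 'rV[R]_n) := x + v.
have ms : measurable_fun setT s := @measurable_rV_shift R n v.
have mf : measurable_fun setT (EFin \o f) by exact: measurable_int intf.
apply/integrableP; split; first exact: (measurableT_comp mf ms).
have /integrableP[_] := intf; congr (_ < _)%E.
transitivity (\int[pushforward mu s]_x `|(EFin \o f) x|)%E.
  apply: eq_measure_integral => A mA _; exact/esym/lebesgue_rV_shift.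
by rewrite ge0_integral_pushforward//; exact: measurableT_comp.
Qed.

Lemma integral_shift f v : mu.-integrable setT (EFin \o f) ->
  (\int[mu]_x (f (x + v))%:E = \int[mu]_x (f x)%:E)%E.
Proof.
move=> intf; pose s (x : 'rV[R]_n) := x + v.
have ms : measurable_fun setT s := @measurable_rV_shift R n v.
transitivity (\int[pushforward mu s]_x (EFin \o f) x)%E; last first.
  apply: eq_measure_integral => A mA _; exact: lebesgue_rV_shift.
rewrite (integral_pushforward ms)//; first exact: measurable_int intf.
exact: integrable_shift.
Qed.

Lemma continuous_bounded_ball f (K : R) : continuous f ->
  exists2 M : R, 0 <= M & forall x, `|x| <= K -> `|f x| <= M.
Proof.
move=> cf; pose C : set 'rV[R]_n := [set x | `|x| <= K].
have cC : compact C.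
  apply: bounded_closed_compact.
    by exists K; split; rewrite ?num_real// => N KN x /le_trans; apply; exact: ltW.
  have cn : continuous (fun x : 'rV[R]_n => `|x|).
    exact: (@norm_continuous _ 'rV[R]_n).
  by move/continuous_closedP : cn => /(_ _ (@closed_le R K)); exact.
have : compact (f @` C) by apply: continuous_compact => //;
  exact: continuous_subspaceT.
move/(@compact_bounded R R^o) => [M [_ CM]]; exists (`|M| + 1);
  first by rewrite addr_ge0.
move=> x Cx; apply: (CM (`|M| + 1)); last by exists x.
by rewrite (le_lt_trans (ler_norm _))// ltrDl.
Qed.

Lemma dominated_convergence_real (F : nat -> 'rV[R]_n -> R) f g :
  (forall k, measurable_fun setT (F k)) -> measurable_fun setT f ->
  {ae mu, forall x, F k x @[k --> \oo] --> f x} ->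
  mu.-integrable setT (EFin \o g) -> (forall k x, `|F k x| <= g x) ->
  mu.-integrable setT (EFin \o f) /\
  (\int[mu]_x (F k x)%:E @[k --> \oo] --> \int[mu]_x (f x)%:E)%E.
Proof.
move=> mF mf Ff ig Fg.
have mF' k : measurable_fun setT (EFin \o F k) by exact/measurable_EFinP.
have mf' : measurable_fun setT (EFin \o f) by exact/measurable_EFinP.
have [] // := @dominated_convergence _ _ _ mu setT measurableT
  (fun k => EFin \o F k) (EFin \o f) (EFin \o g) mF' mf' _ ig.
  by apply: filterS Ff => x Ffx _; apply: cvg_EFin => //; exact: nearW.
by apply: aeW => x k _; rewrite lee_fin.
Qed.

(** Discrete integration by parts: a change of variable moves the forward difference quotient from
    [phi] to a backward one on [u], with a minus sign. The Lipschitz bound dominates the quotients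
    of [u], so both sides pass to the limit. *)
Lemma lipschitz_weak_partial (L : R) u du (i : 'I_n) :
  lipschitz_with L setT u -> measurable_fun setT du ->
  {ae mu, forall x, derivable u x (delta_mx 0 i) /\
                    du x = 'D_(delta_mx 0 i) u x} ->
  weak_partial setT i u du.
Proof.
move=> uL mdu aedu phi [sphi cphi _]; pose v : 'rV[R]_n := delta_mx 0 i.
have cu : continuous u := @lipschitz_with_continuous _ 'rV[R]_n R^o _ _ uL.
have [cphi0 dphi0] := sphi [::]; have [cdphi _] := sphi [:: i];
  rewrite /= in cphi0 dphi0 cdphi.
have {}dphi0 x : derivable phi x v := dphi0 i x.
have [K K0 phiK] : exists2 K : R, 0 <= K & forall x, K < `|x| -> phi x = 0.
  have [K [_ SK]] := @compact_bounded R 'rV[R]_n _ cphi.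
  exists (`|K| + 1); first by rewrite addr_ge0.
  move=> x; apply: contraTeq => phix; rewrite -leNgt.
  apply: (SK (`|K| + 1)); first by rewrite (le_lt_trans (ler_norm _))// ltrDl.
  exact: subset_closure.
pose h (k : nat) : R := k.+1%:R^-1.
have h_gt0 k : 0 < h k by rewrite invr_gt0.
have h_le1 k : h k <= 1 by rewrite invf_le1// ler1n.
have h0 : h @ \oo --> (0 : R) := cvg_harmonic.
have nv : `|v| <= 1.
  apply: norm_le_coord => // j; rewrite mxE eqxx/=.
  by case: (_ == _); rewrite ?normr1 ?normr0.
have hv k x : `|x| <= `|h k *: v + x| + 1.
  rewrite -[X in `|X| <= _](addKr (h k *: v)) addrC (le_trans (ler_normB _ _))//
    lerD2l.
  by rewrite normrZ gtr0_norm// mulr_ile1// ltW.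
(* Steps have length at most 1, so the quotient of [phi] vanishes where |x| > K + 1, and the
   segments used by the mean value theorem stay in |x| <= K + 2. *)
have [M1 M10 dphiM] := continuous_bounded_ball (K + 2) cdphi.
have [M2 M20 uM] := continuous_bounded_ball (K + 1) cu.
have [M3 M30 phiM] := continuous_bounded_ball K cphi0.
pose ind (r : R) (x : 'rV[R]_n) : R := if `|x| <= r then 1 else 0.
have mind r : measurable_fun setT (ind r).
  have -> : ind r = \1_[set x : 'rV[R]_n | `|x - 0| <= r].
    apply/funext => x; rewrite indicE /ind.
    by case: ifPn => xr; [rewrite mem_set//= subr0|rewrite memNset//= subr0;
      exact/negP].
  by apply: measurable_indic; exact: measurable_rV_cube.
have mc (g : 'rV[R]_n -> R) : continuous g -> measurable_fun setT g :=
  @continuous_measurable_rV R n g.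
have cs := @addl_continuous R n.
have cM (g1 g2 : 'rV[R]_n -> R) : continuous g1 -> continuous g2 ->
    continuous (fun x => g1 x * g2 x).
  by move=> c1 c2 x; have c12 := continuousM (c1 x) (c2 x); exact: c12.
have mdq (g : 'rV[R]_n -> R) a :
  continuous g -> measurable_fun setT (diff_quot v g a).
  by move=> cg; apply: mc; exact: continuous_diff_quot.
pose F k x := u x * diff_quot v phi (h k) x.
(* The step is [- h k], since translating the variable by [h k *: v] turns the increment of [phi]
   forwards into an increment of [u] backwards. *)
pose G k x := - (diff_quot v u (- h k) x * phi x).
have mF k : measurable_fun setT (F k).
  by apply: measurable_funM; [exact: mc|exact: mdq].
have mG k : measurable_fun setT (G k).
  by apply: measurableT_comp => //; apply: measurable_funM; [exact: mdq|exact: mc].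
have F_le k x : `|F k x| <= M2 * M1 * ind (K + 1) x.
  rewrite /ind; case: ifPn => [xK|]; last first.
    rewrite -ltNge => Kx; rewrite mulr0 /F /diff_quot !phiK ?subrr ?mulr0 ?normr0//.
      by rewrite (lt_trans _ Kx)// ltrDl.
    by have := hv k x; lra.
  rewrite mulr1 normrM ler_pM//; first exact: uM.
  apply: derivable_diff_quot_le => // t /andP[t0 t1]; apply: dphiM.
  rewrite (le_trans (ler_normD _ _))// normrZ ger0_norm//.
  have : t * `|v| <= 1 by rewrite mulr_ile1// (le_trans t1).
  lra.
have G_le k x : `|G k x| <= `|L| * M3 * ind K x.
  rewrite /ind; case: ifPn => [xK|]; last first.
    by rewrite -ltNge => Kx; rewrite mulr0 /G phiK// mulr0 normrN normr0.
  rewrite mulr1 normrN normrM ler_pM//; last exact: phiM.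
  have := @lipschitz_diff_quot_le u v x L (- h k) uL.
  rewrite oppr_eq0 gt_eqF// => /(_ isT)/le_trans; apply.
  by rewrite ler_piMr.
have iind r : mu.-integrable setT (EFin \o ind r).
  apply: (@integrable_compact_support _ 1 r) => // x; rewrite /ind.
    by move=> ->; rewrite normr1.
  by rewrite ltNge => /negbTE ->.
have iindZ c r : mu.-integrable setT (EFin \o (fun x => c * ind r x)).
  by have := @integrableZl _ _ _ mu setT measurableT c _ (iind r).
have aeF : {ae mu, forall x, (fun k => F k x) @ \oo --> u x * partial i phi x}.
  apply: aeW => x; apply: cvgMr; apply: diff_quot_cvg => // k.
  exact: lt0r_neq0.
have [iFl cvgF] := dominated_convergence_real mF
  (measurable_funM (mc _ cu) (mc _ cdphi)) aeF (iindZ (M2 * M1) (K + 1)) F_le.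
have hN0 : (fun k => - h k) @ \oo --> (0 : R) by rewrite -oppr0; exact: cvgN.
have aeG : {ae mu, forall x, (fun k => G k x) @ \oo --> - (du x * phi x)}.
  apply: filterS aedu => x [dux ->]; apply: cvgN; apply: cvgMl.
  by apply: diff_quot_cvg => // k; rewrite oppr_eq0 lt0r_neq0.
have [iGl cvgG] := dominated_convergence_real mG
  (measurableT_comp (@oppr_measurable R setT) (measurable_funM mdu (mc _ cphi0)))
  aeG (iindZ (`|L| * M3) K) G_le.
(* [F k] is the translate of P minus Q, and [G k] is P - Q. Both P and Q have bounded support
   because of the factor [phi], so the integrals may be split. *)
have FG k : (\int[mu]_x (F k x)%:E = \int[mu]_x (G k x)%:E)%E.
  pose P x := (h k)^-1 * (u (- h k *: v + x) * phi x).
  pose Q x := (h k)^-1 * (u x * phi x).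
  have ics (g : 'rV[R]_n -> R) : continuous g -> (forall x, K < `|x| -> g x = 0) ->
      mu.-integrable setT (EFin \o g).
    move=> cg; have [M M0 gM] := continuous_bounded_ball K cg.
    by move=> g0; apply: integrable_compact_support gM g0; exact: mc.
  have iP : mu.-integrable setT (EFin \o P).
    apply: ics => [|x xK]; last by rewrite /P phiK// !mulr0.
    apply: (cM (cst (h k)^-1)); first by move=> y; exact: cst_continuous.
    apply: cM => // y.
    exact: (@continuous_comp 'rV[R]_n 'rV[R]_n R _ u y (cs (- h k *: v) y) (cu _)).
  have iQ : mu.-integrable setT (EFin \o Q).
    apply: ics => [|x xK]; last by rewrite /Q phiK// !mulr0.
    by apply: (cM (cst (h k)^-1)); [move=> y; exact: cst_continuous|exact: cM].
  transitivity (\int[mu]_x ((P (x + h k *: v))%:E - (Q x)%:E))%E.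
    apply: eq_integral => x _; rewrite -EFinB /F /P /Q /diff_quot.
    have -> : - h k *: v + (x + h k *: v) = x by rewrite scaleNr addrC addrK.
    by rewrite [h k *: v + x]addrC; congr (_%:E); ring.
  rewrite integralB_EFin//; last exact: integrable_shift.
  rewrite integral_shift// -integralB_EFin//.
  apply: eq_integral => x _; rewrite -EFinB /G /P /Q /diff_quot invrN.
  by congr (_%:E); ring.
have e : (\int[mu]_x (u x * partial i phi x)%:E = \int[mu]_x (- (du x * phi
  x))%:E)%E.
  rewrite -(cvg_lim (@ereal_hausdorff R) cvgF) -(cvg_lim (@ereal_hausdorff R) cvgG).
  by congr (limn _); apply/funext => k; exact: FG.
have iduphi : mu.-integrable setT (EFin \o (fun x => du x * phi x)).
  have := integrableN iGl; congr (integrable _ _ _).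
  by apply/funext => x /=; rewrite /= opprK.
transitivity (\int[mu]_x (-1 * (du x * phi x)))%R; last first.
  by rewrite RintegralZl// mulN1r.
by rewrite /Rintegral e; congr fine; apply: eq_integral => x _; rewrite mulN1r.
Qed.

End weak_derivative.

(** * Dilatation bounds from norm bounds *)

Section matrix_distortion.
Context {R : realType} (n : nat).
Implicit Types (v : 'rV[R]_n) (A : 'M[R]_n).

Lemma enorm_ge0 v : 0 <= enorm v.
Proof. exact: sqrtr_ge0. Qed.

Lemma norm_le_enorm v : `|v| <= enorm v.
Proof.
apply: norm_le_coord => [|i]; first exact: enorm_ge0.
rewrite -sqrtr_sqr /enorm ler_wsqrtr// (bigD1 i)//= lerDl.
by apply: sumr_ge0 => j _; exact: sqr_ge0.
Qed.

Lemma enorm_le_norm v : enorm v <= n%:R * `|v|.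
Proof.
rewrite -[leRHS]ger0_norm; last by rewrite mulr_ge0.
rewrite -sqrtr_sqr ler_wsqrtr// exprMn.
apply: (@le_trans _ _ (\sum_(i < n) `|v| ^+ 2)).
  apply: ler_sum => i _; rewrite -[leLHS]real_normK ?num_real//.
  by rewrite lerXn2r// ?nnegrE//; exact: coord_le_norm.
rewrite sumr_const card_ord -[leLHS]mulr_natl ler_wpM2r// ?sqr_ge0//.
by rewrite -natrX ler_nat; case: n => // k; rewrite leq_pmulr.
Qed.

Lemma det_le A (B : R) : (forall i j, `|A i j| <= B) ->
  `|\det A| <= (n`!)%:R * B ^+ n.
Proof.
move=> AB; rewrite /determinant (le_trans (ler_norm_sum _ _ _))//.
apply: (@le_trans _ _ (\sum_(s : 'S_n) B ^+ n)); last first.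
  by rewrite sumr_const card_Sn mulr_natl.
apply: ler_sum => s _; rewrite normrM normrX normrN1 expr1n mul1r normr_prod.
rewrite -[X in B ^+ X](card_ord n) -prodr_const.
by apply: ler_prod => i _; rewrite normr_ge0 AB.
Qed.

Lemma delta_mx_norm (i : 'I_n) : `|delta_mx 0 i : 'rV[R]_n| <= 1.
Proof.
apply: norm_le_coord => // j; rewrite mxE eqxx/=.
by case: (_ == _); rewrite ?normr1 ?normr0.
Qed.

Lemma entry_le A (C : R) (i j : 'I_n) :
  0 <= C -> (forall v, `|v *m A| <= C * `|v|) ->
  `|A i j| <= C.
Proof.
move=> C0 AC; have := AC (delta_mx 0 i); rewrite -rowE => h.
have := coord_le_norm (row i A) j; rewrite mxE => /le_trans; apply.
by rewrite (le_trans h)// ler_piMr// delta_mx_norm.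
Qed.

(** The lower bound on [A] bounds the entries of its inverse by 1/c, so [det_le] applies to the
    inverse. *)
Lemma det_ge A (c : R) : 0 < c -> 0 < \det A -> (forall v, c * `|v| <= `|v *m A|) ->
  ((n`!)%:R * c^-1 ^+ n)^-1 <= \det A.
Proof.
move=> c0 dA Ac; have uA : A \in unitmx by rewrite unitmxE unitfE gt_eqF.
have : `|\det (invmx A)| <= (n`!)%:R * c^-1 ^+ n.
  apply: det_le => i j; apply: entry_le; first by rewrite invr_ge0 ltW.
  by move=> v; rewrite mulrC ler_pdivlMr// mulrC (le_trans (Ac _))// mulmxKV.
rewrite det_inv normrV ?unitfE ?gt_eqF// gtr0_norm// => h.
by rewrite -[leRHS]invrK lef_pV2// posrE ?invr_gt0// mulr_gt0 ?ltr0n ?fact_gt0//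
  exprn_gt0// invr_gt0.
Qed.

(** Only finiteness of the dilatation matters, so the constants are crude: powers of n compare the
    Euclidean norm with the sup norm, and n! comes from the Leibniz formula. A positive [n] makes
    the unit sphere nonempty, so that [sup] and [inf] are meaningful. *)
Lemma distortion_bounds A (C c : R) : (0 < n)%N -> 0 < c -> 0 <= C -> 0 < \det A ->
  (forall v, `|v *m A| <= C * `|v|) -> (forall v, c * `|v| <= `|v *m A|) ->
  [/\ opnorm A ^+ n <= (n%:R * C) ^+ n * ((n`!)%:R * c^-1 ^+ n) * \det A &
      \det A <= (n`!)%:R * C ^+ n * (c^-1 * n%:R) ^+ n * min_stretch A ^+ n].
Proof.
move=> n0 c0 C0 dA AC Ac.
pose e : 'rV[R]_n := delta_mx 0 (Ordinal n0).
have e1 : enorm e = 1.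
  rewrite /enorm (bigD1 (Ordinal n0))//= big1 ?addr0 ?mxE ?eqxx ?expr1n ?sqrtr1//.
  by move=> j jn; rewrite mxE eqxx (negbTE jn) expr0n.
have S0 : [set enorm (h *m A) | h in [set h | enorm h = 1]] !=set0.
  by exists (enorm (e *m A)); exists e.
have n0' : (0 : R) < n%:R by rewrite ltr0n.
have opC : opnorm A <= n%:R * C.
  apply: ge_sup => // _ [h h1 <-];
    rewrite (le_trans (enorm_le_norm _))// ler_pM2l//.
  by rewrite (le_trans (AC h))// ler_piMr// -h1 norm_le_enorm.
have op0 : 0 <= opnorm A.
  apply: (@le_trans _ _ (enorm (e *m A))); first exact: enorm_ge0.
  apply: ub_le_sup; last by exists e.
  exists (n%:R * C) => _ [h h1 <-];
    rewrite (le_trans (enorm_le_norm _))// ler_pM2l//.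
  by rewrite (le_trans (AC h))// ler_piMr// -h1 norm_le_enorm.
have msc : c / n%:R <= min_stretch A.
  apply: lb_le_inf => // _ [h h1 <-]; apply: le_trans (norm_le_enorm _).
  apply: le_trans (Ac h); rewrite ler_pM2l//.
  by rewrite -[leLHS]mul1r ler_pdivrMr// -[leLHS]h1 mulrC enorm_le_norm.
have D0 : 0 < (n`!)%:R * c^-1 ^+ n :> R.
  by rewrite mulr_gt0 ?ltr0n ?fact_gt0// exprn_gt0// invr_gt0.
split.
  rewrite -mulrA -[leLHS]mulr1 ler_pM//; first exact: exprn_ge0.
    by rewrite lerXn2r// nnegrE// mulr_ge0// ltW.
  by rewrite mulrC -ler_pdivrMr// mul1r det_ge.
rewrite -mulrA -exprMn -[leLHS]mulr1 ler_pM//; first exact: ltW.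
  rewrite (le_trans (ler_norm _))// det_le// => i j; exact: entry_le.
rewrite -[leLHS](expr1n _ n) lerXn2r// ?nnegrE//.
  by rewrite !mulr_ge0// ?invr_ge0 ?ltW// (lt_le_trans _ msc)// divr_gt0.
rewrite -(@ler_pM2l _ (c / n%:R)) ?divr_gt0// mulr1 (le_trans msc)//.
rewrite le_eqVlt; apply/orP; left; apply/eqP; field.
by rewrite !gt_eqF.
Qed.

End matrix_distortion.

(* Quantifying over all Lipschitz images makes this class of exceptional sets
   visibly stable under composition of bi-Lipschitz maps. *)
Definition lipschitz_null {R : realType} n (Z : set 'rV[R]_n) :=
  forall L (f : 'rV[R]_n -> 'rV[R]_n), lipschitz_with L setT f ->
    (lebesgue_rV n).-negligible (f @` Z).

(** The Jacobian is asked to be positive without a uniform lower bound: the Lipschitz inverse will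
    supply one. *)
Definition bilip_qc {R : realType} n (F : 'rV[R]_n -> 'rV[R]_n) :=
  exists (G : 'rV[R]_n -> 'rV[R]_n) (L : R) (Z : set 'rV[R]_n),
  [/\ cancel F G, cancel G F, lipschitz_with L setT F, lipschitz_with L setT G &
      lipschitz_null Z /\
      forall x, ~ Z x -> differentiable F x /\ 0 < \det ('J F x)].

(** * Bi-Lipschitz maps as Sobolev maps *)

Section bilipschitz_sobolev.
Context {R : realType} (n : nat).
Implicit Types (F G : 'rV[R]_n -> 'rV[R]_n) (x v : 'rV[R]_n).
Local Notation mu := (lebesgue_rV n).

Lemma lipschitz_null_negligible (Z : set 'rV[R]_n) :
  lipschitz_null Z -> mu.-negligible Z.
Proof.
by move=> /(_ 1 id); rewrite image_id; apply => x y _ _; rewrite mul1r.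
Qed.

Lemma derive_norm_bounds F x v (a b : R) : derivable F x v ->
  (forall h, h != 0 -> a <= `|h^-1 *: (F (h *: v + x) - F x)| <= b) ->
  a <= `|'D_v F x| <= b.
Proof.
move=> dF ab.
have dn : (fun h => `|h^-1 *: ((F \o shift x) (h *: v) - F x)|) @ 0^' -->
    `|'D_v F x|.
  exact: (@cvg_norm _ 'rV[R]_n).
have {}ab : \forall h \near (0 :
  R)^', a <= `|h^-1 *: ((F \o shift x) (h *: v) - F x)| <= b.
  have := @nbhs_dnbhs_neq R 0; apply: filterS => h /ab; exact.
apply/andP; split; [apply: cvgr_to_ge dn _|apply: cvgr_to_le dn _].
  by apply: filterS ab => h /andP[].
by apply: filterS ab => h /andP[].
Qed.

(** The difference quotients of [F] are bounded above by its own Lipschitz constant and below by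
    that of [G], applied to the images of the two points. *)
Lemma bilipschitz_jacobian F G (L : R) x : 0 < L -> cancel F G ->
  lipschitz_with L setT F -> lipschitz_with L setT G -> differentiable F x ->
  forall v, L^-1 * `|v| <= `|v *m 'J F x| <= L * `|v|.
Proof.
move=> L0 FK FL GL dF v; rewrite -deriveEjacobian//.
apply: derive_norm_bounds; first exact: diff_derivable.
move=> h h0; have hn : 0 < `|h| by rewrite normr_gt0.
have hv : `|h *: v| = `|(h *: v + x) - x| by rewrite addrK.
rewrite normrZ normfV; apply/andP; split.
  rewrite ler_pdivrMl// mulrCA ler_pdivlMl// -normrZ hv.
  by have := GL (F (h *: v + x)) (F x) I I; rewrite !FK.
by rewrite ler_pdivrMl// mulrCA -normrZ hv FL.
Qed.

Lemma Lp_loc_bounded (p : nat) (f : 'rV[R]_n -> R) : measurable_fun setT f ->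
  (forall K : R, exists M : R, forall x, `|x| <= K -> `|f x| <= M) ->
  Lp_loc p setT f.
Proof.
move=> mf fb; split => // C cC _.
have mC : measurable C.
  by apply: closed_measurable_rV; apply: compact_closed => //;
    exact: norm_hausdorff.
have [K [_ CK]] := @compact_bounded R 'rV[R]_n _ cC.
have {}CK x : C x -> `|x| <= `|K| + 1.
  by apply: CK; rewrite (le_lt_trans (ler_norm _))// ltrDl.
have [M fM] := fb (`|K| + 1).
apply: measurable_bounded_integrable => //.
- apply: (@le_lt_trans _ _ (mu [set x | `|x - 0| <= `|K| + 1])).
    apply: le_measure; rewrite ?inE//; first exact: measurable_rV_cube.
    by move=> x /CK; rewrite /= subr0.
  by rewrite (le_lt_trans (lebesgue_rV_cube _ _)) ?ltry// addr_ge0.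
- apply: measurable_funX; apply: measurable_funS (measurableT) _ _ => //.
  exact: measurableT_comp.
- exists (M ^+ p); split; rewrite ?num_real// => N MN x Cx /=.
  rewrite (le_trans _ (ltW MN))// normrX normr_id lerXn2r// ?nnegrE//.
    by rewrite (le_trans _ (fM x (CK x Cx))).
  exact: fM (CK x Cx).
Qed.

Lemma lipschitz_coord F (L : R) j : lipschitz_with L setT F ->
  lipschitz_with L setT (fun x => F x ord0 j : R^o).
Proof.
move=> FL x y _ _; rewrite (le_trans _ (FL x y I I))//.
by have := coord_le_norm (F x - F y) j; rewrite !mxE.
Qed.

Lemma lipschitz_sobolev (p : nat) F (L : R) : 0 <= L -> lipschitz_with L setT F ->
  {ae mu, forall x, differentiable F x} ->
  exists2 Df : 'rV[R]_n -> 'M[R]_n, sobolev_loc p setT F Df &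
    {ae mu, forall x, Df x = 'J F x}.
Proof.
move=> L0 FL dF.
pose h (k : nat) : R := k.+1%:R^-1.
have h_neq0 k : h k != 0 by rewrite invr_eq0 pnatr_eq0.
pose fj j : 'rV[R]_n -> R := fun x => F x ord0 j.
have fjL j : lipschitz_with L setT (fj j : _ -> R^o) by exact: lipschitz_coord.
have cfj j : continuous (fj j) by exact: (lipschitz_with_continuous (fjL j)).
have Dle (i j : 'I_n) k x : `|diff_quot (delta_mx 0 i) (fj j) (h k) x| <= L.
  rewrite (le_trans (lipschitz_diff_quot_le _ _ (fjL j) _))// ger0_norm//.
  by rewrite ler_piMr// delta_mx_norm.
pose D (i j : 'I_n) x : R :=
  limn_sup (fun k => diff_quot (delta_mx 0 i) (fj j) (h k) x).
(* The upper limit makes [Df] Borel everywhere, the truncation bounded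
   everywhere; neither changes it where [F] is differentiable. *)
pose Df x : 'M[R]_n := \matrix_(i, j) Num.max (- L) (Num.min L (D i j x)).
have mD i j : measurable_fun setT (D i j).
  apply: measurable_fun_limn_sup => [x _|x _|k].
  - by exists L => _ [k _ <-]; rewrite (le_trans (ler_norm _)).
  - exists (- L) => _ [k _ <-]; have := Dle i j k x.
    by rewrite ler_norml => /andP[].
  - by apply: continuous_measurable_rV; exact: continuous_diff_quot.
have JDf x : differentiable F x -> Df x = 'J F x.
  move=> dFx; apply/matrixP => i j; rewrite mxE.
  have dFe : derivable F x (delta_mx 0 i) by exact: diff_derivable.
  have dfj := (derivable_mxP _ _ _).1 dFe ord0 j.
  have h0 : h @ \oo --> (0 : R) := cvg_harmonic.
  have Dcvg := diff_quot_cvg dfj h0 h_neq0.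
  have De : D i j x = 'J F x i j.
    rewrite /D cvg_limn_supE; last by apply/cvg_ex; eexists; exact: Dcvg.
    rewrite (cvg_lim _ Dcvg)//; have := derive_mx dFe.
    by rewrite deriveEjacobian// -rowE => /matrixP/(_ ord0 j); rewrite !mxE.
  have : `|D i j x| <= L.
    have nD : `|diff_quot (delta_mx 0 i) (fj j) (h k) x| @[k --> \oo] --> `|D i j
      x|.
      rewrite De; have := derive_mx dFe.
      rewrite deriveEjacobian// -rowE => /matrixP/(_ ord0 j); rewrite !mxE => ->.
      exact: (@cvg_norm _ R^o).
    by apply: cvgr_to_le nD _; exact: nearW.
  by rewrite De ler_norml => /andP[h1 h2]; rewrite (min_idPr h2) (max_idPr h1).
exists Df; last by apply: filterS dF => x; exact: JDf.
split=> [j|i j].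
  apply: Lp_loc_bounded; first exact: (continuous_measurable_rV (cfj j)).
  move=> K; have [M _ ?] := continuous_bounded_ball K (cfj j).
  by exists M.
have mDf : measurable_fun setT (fun x => Df x i j).
  under eq_fun do rewrite mxE.
  by apply: measurable_maxr => //; exact: measurable_minr.
split.
  apply: Lp_loc_bounded => // K; exists L => x _; rewrite mxE ler_norml.
  by rewrite le_max lexx/= ge_max ge_min lexx/= andbT (le_trans _ L0)// oppr_le0.
apply: (lipschitz_weak_partial (fjL j) mDf).
apply: filterS dF => x dFx; rewrite JDf//.
have dFe : derivable F x (delta_mx 0 i) by exact: diff_derivable.
split; first exact: (derivable_mxP _ _ _).1.
have := derive_mx dFe; rewrite deriveEjacobian// -rowE => /matrixP/(_ ord0 j).
by rewrite !mxE.
Qed.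

End bilipschitz_sobolev.

(** * Extension to the one-point compactification *)

Section euclidean_norm.
Context {R : realType} (n : nat).
Implicit Types u v w : 'rV[R]_n.

Lemma dotC u v : dot u v = dot v u.
Proof. by apply: eq_bigr => i _; rewrite mulrC. Qed.

Lemma dotDl u v w : dot (u + v) w = dot u w + dot v w.
Proof. by rewrite -big_split; apply: eq_bigr => i _; rewrite mxE mulrDl. Qed.

Lemma dotZl (a : R) u v : dot (a *: u) v = a * dot u v.
Proof. by rewrite mulr_sumr; apply: eq_bigr => i _; rewrite mxE mulrA. Qed.

Lemma dotNl u v : dot (- u) v = - dot u v.
Proof. by rewrite -scaleN1r dotZl mulN1r. Qed.

Lemma dotDr u v w : dot w (u + v) = dot w u + dot w v.
Proof. by rewrite dotC dotDl !(dotC w). Qed.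

Lemma dotZr (a : R) u v : dot u (a *: v) = a * dot u v.
Proof. by rewrite dotC dotZl dotC. Qed.

Lemma dotNr u v : dot u (- v) = - dot u v.
Proof. by rewrite dotC dotNl dotC. Qed.

Lemma dot_ge0 v : 0 <= dot v v.
Proof. by apply: sumr_ge0 => i _; rewrite -expr2 sqr_ge0. Qed.

Lemma enormE v : enorm v = Num.sqrt (dot v v).
Proof. by congr Num.sqrt; apply: eq_bigr => i _; rewrite expr2. Qed.

Lemma enorm_sqr v : enorm v ^+ 2 = dot v v.
Proof. by rewrite enormE sqr_sqrtr// dot_ge0. Qed.

Lemma enorm_eq0 v : (enorm v == 0) = (v == 0).
Proof.
apply/idP/eqP => [/eqP v0|->].
  by apply/eqP; rewrite -normr_le0 -v0 norm_le_enorm.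
by rewrite enormE -(scale0r (0 : 'rV[R]_n)) dotZl mul0r sqrtr0.
Qed.

Lemma enormZ (a : R) v : enorm (a *: v) = `|a| * enorm v.
Proof.
by rewrite !enormE dotZl dotZr mulrA -expr2 sqrtrM ?sqr_ge0// sqrtr_sqr.
Qed.

Lemma enormN v : enorm (- v) = enorm v.
Proof. by rewrite -scaleN1r enormZ normrN1 mul1r. Qed.

(** Cauchy-Schwarz, from the square of |v| u - |u| v being nonnegative. *)
Lemma dot_le_enorm u v : dot u v <= enorm u * enorm v.
Proof.
have [->|v0] := eqVneq v 0.
  by rewrite -(scale0r (0 : 'rV[R]_n)) dotZr mul0r enormZ normr0 mul0r mulr0.
have nv : 0 < enorm v by rewrite lt_def enorm_eq0 v0 enorm_ge0.
have := dot_ge0 (enorm v *: u - (enorm u) *: v).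
rewrite !(dotDl, dotDr, dotNl, dotNr, dotZl, dotZr) -!enorm_sqr (dotC v u).
have [->|u0] := eqVneq u 0.
  by rewrite -(scale0r (0 : 'rV[R]_n)) dotZl mul0r enormZ normr0 !mul0r.
have nu : 0 < enorm u by rewrite lt_def enorm_eq0 u0 enorm_ge0.
move=> h; rewrite -(ler_pM2l (mulr_gt0 nu nv)); nra.
Qed.

Lemma normr_dot_le u v : `|dot u v| <= enorm u * enorm v.
Proof.
rewrite ler_norml dot_le_enorm andbT lerNl -dotNl.
by rewrite -(enormN u) dot_le_enorm.
Qed.

Lemma enormD u v : enorm (u + v) <= enorm u + enorm v.
Proof.
rewrite -(@ler_pXn2r _ 2)// ?nnegrE ?addr_ge0 ?enorm_ge0//.
rewrite enorm_sqr !(dotDl, dotDr) -!enorm_sqr (dotC v u) sqrrD.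
by have := dot_le_enorm u v; lra.
Qed.

Lemma enorm_dist u v : `|enorm u - enorm v| <= enorm (u - v).
Proof.
rewrite ler_norml; apply/andP; split.
  have := enormD (v - u) u; rewrite subrK -opprB enormN; lra.
by have := enormD (u - v) v; rewrite subrK; lra.
Qed.

Lemma enorm_lipschitz : lipschitz_with n%:R setT (@enorm R n : 'rV[R]_n -> R^o).
Proof. by move=> u v _ _; exact: le_trans (enorm_dist _ _) (enorm_le_norm _). Qed.

Lemma eball_open (x : 'rV[R]_n) (r : R) : open (eball x r).
Proof.
have ce : continuous (fun z : 'rV[R]_n => enorm (z - x)).
  apply: (@lipschitz_with_continuous _ 'rV[R]_n R^o n%:R) => u v _ _.
  by rewrite (le_trans (enorm_lipschitz _ _))// opprB addrA subrK.
by move/continuousP : ce => /(_ _ (@open_lt R r)); exact.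
Qed.

End euclidean_norm.

Section one_point_extension.
Context {R : realType} (n : nat).
Local Notation Rbar := (one_point_compactification 'rV[R]_n).

Lemma star_connected (A : set 'rV[R]_n) :
  (forall v (t : R), A v -> 0 <= t <= 1 -> A (t *: v)) -> connected A.
Proof.
move=> starA; have -> : A = \bigcup_(v in A) [set t *: v | t in `[0, 1 : R]].
  apply/seteqP; split => [v Av|_ [v Av [t t01 <-]]].
    by exists v => //; exists 1; rewrite ?scale1r//= in_itv/= lexx ler01.
  by apply: starA => //; move: t01; rewrite /= in_itv.
apply: bigcup_connected.
  exists 0 => v Av /=; exists 0; first by rewrite in_itv/= lexx ler01.
  by rewrite scale0r.
move=> v Av; apply: connected_continuous_connected; first exact: segment_connected.
apply: continuous_subspaceT.
apply: (@lipschitz_with_continuous _ R^o 'rV[R]_n `|v|) => s t _ _.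
by rewrite -scalerBl normrZ mulrC.
Qed.

(** At infinity, neighbourhoods are given by complements of closed compact sets, and the preimage of
    such a set under [F] is compact as its image under the continuous [G]. *)
Lemma omap_continuous (F G : 'rV[R]_n -> 'rV[R]_n) :
  continuous F -> continuous G -> cancel F G -> cancel G F ->
  continuous (omap F : Rbar -> Rbar).
Proof.
move=> cF cG FK GK [x|] A.
  by move=> h; exact: (cF x _ h).
case=> U [cU clU] UA; exists (F @^-1` U).
  split; last by move/continuous_closedP : cF; exact.
  have -> : F @^-1` U = G @` U.
    apply/seteqP; split => [y Uy|_ [y Uy <-]]; last by rewrite /= GK.
    by exists (F y).
  by apply: continuous_compact => //; exact: continuous_subspaceT.
move=> [y [[z Uz [<-]]|//]|_]; last by apply: UA; right.
by apply: UA; left; exists (F z).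
Qed.

(** The quasiconformal map is [omap F]. Almost everywhere its Jacobian matrix is bounded above and
    below through the Lipschitz constants of [F] and its inverse, which bounds both dilatations. *)
Theorem bilip_qc_quasiball (F : 'rV[R]_n -> 'rV[R]_n) : (0 < n)%N -> bilip_qc F ->
  quasiball (Some @` (F @` eball 0 1) : set Rbar).
Proof.
move=> n0 [G [L0 [Z [FK GK FL0 GL0 [nZ dF]]]]].
pose L : R := `|L0| + 1; have L_gt0 : 0 < L by rewrite ltr_wpDl.
have lip (H : 'rV[R]_n -> 'rV[R]_n) :
  lipschitz_with L0 setT H -> lipschitz_with L setT H.
  move=> HL x y _ _; rewrite (le_trans (HL x y I I))// ler_wpM2r//.
  by rewrite (le_trans (ler_norm _))// lerDl.
have FL := lip F FL0; have GL := lip G GL0.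
have cF := lipschitz_with_continuous FL; have cG := lipschitz_with_continuous GL.
have aedF : {ae lebesgue_rV n, forall x, differentiable F x /\ 0 < \det ('J F x)}.
  apply: negligibleS (lipschitz_null_negligible nZ) => x /= h.
  by apply: contrapT => /dF.
have [||Df sDf JDf] := @lipschitz_sobolev R n n F L _ FL; first exact: ltW.
  by apply: filterS aedF => x [].
pose C1 := (n%:R * L) ^+ n * ((n`!)%:R * (L^-1)^-1 ^+ n).
pose C2 := (n`!)%:R * L ^+ n * ((L^-1)^-1 * n%:R) ^+ n.
(* A sum rather than a maximum: it is at least 1 and dominates the outer constant [C1] and the inner
   constant [C2]. *)
pose K := 1 + C1 + C2.
have C10 : 0 <= C1.
  by apply: mulr_ge0; [|apply: mulr_ge0 => //];
    rewrite exprn_ge0// ?invrK ?mulr_ge0// ltW.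
have C20 : 0 <= C2.
  apply: mulr_ge0; [apply: mulr_ge0 => //|];
    rewrite exprn_ge0// ?invrK ?mulr_ge0// ltW//.
have K1 : 1 <= K by rewrite /K; lra.
have dist : {ae lebesgue_rV n, forall x, 0 < \det (Df x) /\
  [/\ opnorm (Df x) ^+ n <= C1 * \det (Df x) &
      \det (Df x) <= C2 * min_stretch (Df x) ^+ n]}.
  apply: filterS2 aedF JDf => x [dFx detx] ->; split => //.
  have J := bilipschitz_jacobian L_gt0 FK FL GL dFx.
  apply: distortion_bounds => //; rewrite ?invr_gt0 ?ltW//.
    by move=> v; have /andP[] := J v.
  by move=> v; have /andP[] := J v.
have oK : outer_bound setT Df K.
  apply: filterS dist => x [d0 [h _]] _; rewrite (le_trans h)// ler_wpM2r ?ltW//.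
  by rewrite /K; lra.
have iK : inner_bound setT Df K.
  apply: filterS dist => x [d0 [_ h]] _; rewrite (le_trans h)// ler_wpM2r//;
    last by rewrite /K; lra.
  (* The power of [min_stretch] cannot be negative: times the nonnegative [C2] it dominates a
     positive determinant. *)
  by rewrite leNgt; apply/negP => m0; have := lt_le_trans d0 h;
    rewrite ltNge mulr_ge0_le0// ltW.

exists K; split.
  split.
  - apply: one_point_compactification_open_some.
    have -> : F @` eball 0 1 = G @^-1` eball 0 1.
      apply/seteqP; split => [_ [y By <-]|y By]; first by rewrite /= FK.
      by exists (G y).
    by move/continuousP : cG; apply; exact: eball_open.
  - apply: connected_continuous_connected; last first.
      exact/continuous_subspaceT/one_point_compactification_some_continuous.
    apply: connected_continuous_connected; last exact: continuous_subspaceT.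
    apply: star_connected => v t; rewrite /eball/= !subr0 enormZ => v1 /andP[t0 t1].
    by rewrite ger0_norm// (le_lt_trans _ v1)// ler_piMl// enorm_ge0.
  - exists (Some (F 0)); exists (F 0) => //; exists 0 => //=.
    by rewrite /eball/= subrr (eqP (_ : enorm 0 == 0)) ?enorm_eq0.
exists (omap F); last first.
  by rewrite [LHS]image_comp [RHS]image_comp.
split.
- exact: omap_continuous cF cG FK GK.
- exists (omap G); split; first exact: omap_continuous cG cF GK FK.
    by case=> //= x; rewrite FK.
  by case=> //= x; rewrite GK.
(* [omap F] sends no finite point to infinity, so quasiconformality is required on all of R^n. *)
rewrite (_ : [set x | _] = setT); last by apply/seteqP; split.
rewrite (_ : finite_part _ = F); last by apply/funext.
split; last first.
  split; first exact: continuous_subspaceT.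
  by exists G; split; [exact: continuous_subspaceT|move=> x _; rewrite FK].
split; last first.
  rewrite ge_max; apply/andP; split; apply: ereal_inf_lbound; exists K => //.
    by split => //; exists Df.
  by split => //; exists Df.
split; first 2 last.
- by exists Df => //; exists K.
- split; first exact: openT.
    exact: star_connected.
  by exists 0.
- exact: continuous_subspaceT.
Qed.

End one_point_extension.

(** * Calculus of bi-Lipschitz maps with positive Jacobian *)

Section lipschitz_calculus.
Context {R : realType}.

Lemma lipschitz_with_ge (V W : normedModType R) (L M : R) (A : set V) (f : V -> W) :
  L <= M -> lipschitz_with L A f -> lipschitz_with M A f.
Proof.
by move=> LM fL x y Ax Ay; rewrite (le_trans (fL x y Ax Ay))// ler_wpM2r.
Qed.

Lemma lipschitz_with_comp (U V W : normedModType R) (L M : R) (A : set U)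
    (f : U -> V) (g : V -> W) : 0 <= M ->
  lipschitz_with M setT g -> lipschitz_with L A f ->
    lipschitz_with (M * L) A (g \o f).
Proof.
move=> M0 gM fL x y Ax Ay; rewrite (le_trans (gM _ _ I I))// -mulrA.
by rewrite ler_wpM2l// fL.
Qed.

Lemma lipschitz_nullU n (Y Z : set 'rV[R]_n) :
  lipschitz_null Y -> lipschitz_null Z -> lipschitz_null (Y `|` Z).
Proof.
move=> nY nZ L f fL; rewrite image_setU.
by apply: negligibleU; [exact: nY fL|exact: nZ fL].
Qed.

Lemma lipschitz_nullS n (Y Z : set 'rV[R]_n) :
  Y `<=` Z -> lipschitz_null Z -> lipschitz_null Y.
Proof.
by move=> YZ nZ L f fL; apply: negligibleS (nZ L f fL); exact: image_subset.
Qed.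

Lemma lipschitz_null_image n (Z : set 'rV[R]_n) (L : R) (f : 'rV[R]_n -> 'rV[R]_n) :
  lipschitz_with L setT f -> lipschitz_null Z -> lipschitz_null (f @` Z).
Proof.
move=> fL nZ M g gM; rewrite image_comp.
apply: (nZ (`|M| * L)); apply: lipschitz_with_comp => //.
exact: lipschitz_with_ge (ler_norm M) gM.
Qed.

Lemma hyperplane_lipschitz_null n (w : 'rV[R]_n) (c L : R)
    (E : set 'rV[R]_n) (f : 'rV[R]_n -> 'rV[R]_n) :
  w != 0 -> (forall x, E x -> dot w x = c) -> lipschitz_with L E f ->
  lipschitz_null (f @` E).
Proof.
move=> w0 Ew fL M g gM; rewrite image_comp.
apply: (hyperplane_lipschitz_negligible (L := `|M| * L) w0 Ew).
apply: lipschitz_with_comp => //; exact: lipschitz_with_ge (ler_norm M) gM.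
Qed.

End lipschitz_calculus.

(** * Jacobians of compositions and of radial maps *)

Section jacobian_calculus.
Context {R : realType}.

Lemma near_eq_differentiable (V W : normedModType R) (f g : V -> W) (x : V) :
  (\forall y \near x, f y = g y) -> differentiable f x -> differentiable g x.
Proof.
move=> fg df; have gfx : g x = f x by apply/esym/(nbhs_singleton fg).
have cdf : continuous ('d f x) by exact: diff_continuous.
have e : g \o shift x = cst (g x) + 'd f x +o_ (0 : V) id.
  apply/eqaddoP => e e0.
  have := diff_locally df => /eqaddoP/(_ e e0) fe.
  have fg0 : \forall h \near (0 : V), f (h + x) = g (h + x).
    by move/nbhs0P : fg; apply: filterS => h; rewrite addrC.
  near=> h; rewrite /= !fctE /= -(near fg0 h)//= gfx.
  by near: h.
apply/diff_locallyP; rewrite (diff_unique cdf e); split => //.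
Unshelve. all: by end_near. Qed.

Lemma jacobian_entry n (F : 'rV[R]_n -> 'rV[R]_n) x i j :
  differentiable F x -> 'J F x i j = 'D_(delta_mx 0 i) (fun y => F y ord0 j) x.
Proof.
move=> dF; have dFe : derivable F x (delta_mx 0 i) by exact: diff_derivable.
have := derive_mx dFe; rewrite deriveEjacobian// -rowE => /matrixP/(_ ord0 j).
by rewrite !mxE.
Qed.

Lemma near_eq_jacobian n (F G : 'rV[R]_n -> 'rV[R]_n) x :
  (\forall y \near x, F y = G y) -> differentiable F x -> 'J G x = 'J F x.
Proof.
move=> FG dF; have dG := near_eq_differentiable FG dF.
apply/matrixP => i j; apply: (etrans (jacobian_entry i j dG)).
apply: (etrans _ (esym (jacobian_entry i j dF))); apply: near_eq_derive.
by apply: filterS FG => y ->.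
Qed.

Lemma jacobian_comp n (F G : 'rV[R]_n -> 'rV[R]_n) x :
  differentiable F x -> differentiable G (F x) ->
  'J (G \o F) x = 'J F x *m 'J G (F x).
Proof.
move=> dF dG; have dGF : differentiable (G \o F) x by exact: differentiable_comp.
apply/row_matrixP => i; rewrite !rowE mulmxA.
apply: (etrans (esym (deriveEjacobian _ dGF))).
have <- := deriveEjacobian (delta_mx 0 i) dF.
apply: (etrans _ (deriveEjacobian _ dG)).
apply: (etrans (deriveE _ dGF)); apply: (etrans _ (esym (deriveE _ dG))).
apply: (etrans (congr1 (fun k => k (delta_mx 0 i)) (diff_comp dF dG))).
exact: (congr1 ('d G (F x)) (esym (deriveE _ dF))).
Qed.

(** The matrix determinant lemma: the block matrix [B] is made triangular by a row elimination and
    by a column elimination, giving its determinant in two ways. *)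
Lemma det_scalar_add_rank1 n (s : R) (c : 'cV[R]_n) (r : 'rV[R]_n) : s != 0 ->
  \det (s%:M + c *m r) = s ^+ n * (1 + s^-1 * (r *m c) 0 0).
Proof.
move=> s0; pose B := block_mx (1%:M : 'M[R]_1) (- r) c s%:M.
have e1 : block_mx 1%:M 0 (- c) 1%:M *m B = block_mx 1%:M (- r) 0 (s%:M + c *m r).
  rewrite /B mulmx_block !mul1mx !mul0mx !addr0 !mulmx1 mulmxN mulNmx opprK addNr.
  by rewrite [X in block_mx _ _ _ X]addrC.
have e2 : B *m block_mx 1%:M 0 (- s^-1 *: c) 1%:M =
    block_mx (1%:M + s^-1 *: (r *m c)) (- r) 0 s%:M.
  rewrite /B mulmx_block !mulmx1 !mulmx0 !add0r mul_scalar_mx scalerA mulrN.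
  by rewrite mulfV// scaleN1r subrr mulNmx -scalemxAr scaleNr opprK.
have := congr1 determinant e1;
  rewrite det_mulmx det_lblock det_ublock !det1 !mul1r => <-.
have := congr1 determinant e2;
  rewrite det_mulmx det_lblock det_ublock !det1 !mulr1 => ->.
by rewrite det_scalar det_mx11 !mxE mulrC.
Qed.

Lemma derive_coord n (x v : 'rV[R]_n) (j : 'I_n) :
  is_derive x v (fun y : 'rV[R]_n => y ord0 j) (v ord0 j).
Proof.
have dj : derivable (fun y : 'rV[R]_n => y ord0 j) x v.
  by apply: diff_derivable; exact: differentiable_coord.
apply: DeriveDef => //.
have e : (fun h : R => h^-1 *: ((h *: v + x) ord0 j - x ord0 j)) @ 0^' --> v ord0 j.
  apply: cvg_near_cst; have := @nbhs_dnbhs_neq R 0; apply: filterS => h h0.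
  by rewrite !mxE addrK [_ *: _]mulKf.
exact: (cvg_lim _ e).
Qed.

(** The Jacobian matrix is s I plus a rank one matrix built from the gradient of [s] and [x], so its
    determinant is s^(n-1) (s + D_x s). *)
Lemma radial_jacobian n (s : 'rV[R]_n -> R) (x : 'rV[R]_n) : differentiable s x ->
  0 < s x -> 0 < s x + 'D_x s x ->
  differentiable (fun y => s y *: y) x /\ 0 < \det ('J (fun y => s y *: y) x).
Proof.
move=> ds s0 sx0; pose F (y : 'rV[R]_n) := s y *: y.
have dF : differentiable F x.
  have -> : F = \sum_(j < n) (fun y => (s y * y ord0 j) *: (delta_mx 0 j :
    'rV[R]_n)).
    apply/funext => y; rewrite fct_sumE /F [X in _ *: X](row_sum_delta y).
    by rewrite scaler_sumr; apply: eq_bigr => j _; rewrite scalerA.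
  apply: differentiable_sum => j; apply: differentiableZl.
  by apply: differentiableM => //; exact: differentiable_coord.
have JF : 'J F x = (s x)%:M + (\col_i 'D_(delta_mx 0 i) s x) *m x.
  apply/matrixP => i j; apply: (etrans (jacobian_entry i j dF)).
  rewrite !mxE big_ord1 !mxE.
  under [in LHS]eq_fun do rewrite mxE.
  have dsx : derivable s x (delta_mx 0 i) by exact: diff_derivable.
  have dj := derive_coord x (delta_mx 0 i) j.
  rewrite (deriveM dsx (@ex_derive _ _ _ _ _ _ _ dj)) derive_val !mxE eqxx/=.
  by rewrite [_ *: _]mulr_natr eq_sym [_ *: _]mulrC.
split => //; rewrite -/F JF det_scalar_add_rank1 ?gt_eqF//.
rewrite mulr_gt0// ?exprn_gt0// -(ltr_pM2l s0) mulr0 mulrDr mulr1 mulVKf ?gt_eqF//.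
have -> : (x *m (\col_i 'D_(delta_mx 0 i) s x)) 0 0 = 'D_x s x; last by [].
rewrite deriveE// [X in 'd s x X](row_sum_delta x) linear_sum mxE.
by apply: eq_bigr => i _; rewrite mxE linearZ deriveE.
Qed.

End jacobian_calculus.

Section bilip_qc_closure.
Context {R : realType} (n : nat).
Implicit Types (F G : 'rV[R]_n -> 'rV[R]_n).

Lemma bilip_qc_comp F G : bilip_qc F -> bilip_qc G -> bilip_qc (G \o F).
Proof.
move=> [F' [L [Z [FK KF FL F'L [nZ dF]]]]] [G' [M [Y [GK KG GM G'M [nY dG]]]]].
(* The preimage of [Y] under [F] is its image under the Lipschitz inverse, hence again
   [lipschitz_null]. *)
exists (F' \o G'), (`|L| * `|M|), (Z `|` F' @` Y).
have abs K H : lipschitz_with K setT H -> lipschitz_with `|K| setT H.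
  exact: lipschitz_with_ge (ler_norm K).
split.
- exact: can_comp.
- exact: can_comp.
- by rewrite mulrC; apply: lipschitz_with_comp; [|exact: abs GM|exact: abs FL].
- by apply: lipschitz_with_comp; [|exact: abs F'L|exact: abs G'M].
split; first by apply: lipschitz_nullU => //; exact: lipschitz_null_image F'L nY.
move=> x /not_orP[/dF[dFx J1] nYx].
have /dG[dGx J2] : ~ Y (F x) by move=> YFx; apply: nYx; exists (F x).
split; first exact: differentiable_comp.
rewrite (jacobian_comp dFx dGx) det_mulmx; exact: (mulr_gt0 J1 J2).
Qed.

Lemma bilip_qc_affine (p : 'rV[R]_n) (h : R) : 0 < h ->
  bilip_qc (fun y => p + h *: y).
Proof.
move=> h0; exists (fun y => h^-1 *: (y - p)), (h + h^-1), set0.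
have hV : 0 < h^-1 by rewrite invr_gt0.
split.
- by move=> y; rewrite addrC addKr scalerA mulVf ?gt_eqF// scale1r.
- by move=> y; rewrite scalerA mulfV ?gt_eqF// scale1r addrC subrK.
- move=> x y _ _; rewrite opprD addrACA subrr add0r -scalerBr normrZ gtr0_norm//.
  by rewrite ler_wpM2r// lerDl ltW.
- move=> x y _ _; rewrite -scalerBr opprB addrA subrK normrZ gtr0_norm//.
  by rewrite ler_wpM2r// lerDr ltW.
split; first by move=> L f _; rewrite image_set0; exact: negligible_set0.
move=> x _.
(* The dilation is the radial map with constant factor [h]; the translation does not change the
   Jacobian matrix. *)
have hD : 0 < h + 'D_x (cst h : 'rV[R]_n -> R) x by rewrite derive_cst addr0.
have [dh Jh] := radial_jacobian (differentiable_cst h x) h0 hD.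
have dp : differentiable (fun y : 'rV[R]_n => p + h *: y) x.
  exact: (@differentiableD _ _ _ (cst p) (fun y => h *: y)).
split; first exact: dp.
suff -> : 'J (fun y : 'rV[R]_n => p + h *: y) x = 'J (fun y => cst h y *: y) x.
  exact: Jh.
apply/matrixP => i j; apply: (etrans (jacobian_entry i j dp)).
apply: (etrans _ (esym (jacobian_entry i j dh))).
have dhj : derivable (fun y : 'rV[R]_n => (h *: y) ord0 j) x (delta_mx 0 i).
  have dhe : derivable (fun y :
    'rV[R]_n => h *: y) x (delta_mx 0 i) by exact: diff_derivable.
  exact: ((derivable_mxP _ _ _).1 dhe ord0 j).
have e1 := deriveD (derivable_cst (p ord0 j) x (delta_mx 0 i)) dhj.
have e2 := derive_cst (p ord0 j) x (delta_mx 0 i).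
apply: (etrans _ (etrans e1 (etrans (congr1 (+%R^~ _) e2) (add0r _)))).
by congr (derive _ _ _); apply/funext => y; rewrite mxE.
Qed.

End bilip_qc_closure.

(** * Stretching one star-shaped domain onto another *)

Section radial_profile.
Context {R : realType}.
Implicit Types (d k t : R).

(** For 0 < d < 1 <= k, the function t * stretch(t) is kt up to t = 1, then dt + (k - d), and
    becomes t once these two agree. It is thus an increasing piecewise linear map of the
    half-line. *)
Definition stretch d k t : R := Num.max 1 (d + (k - d) / Num.max 1 t).

(** The factor of the inverse map: t/k up to t = k, then (t - k + d)/d, then t. *)
Definition shrink d k t : R := Num.min 1 (d^-1 - (k - d) / (d * Num.max k t)).

Lemma stretch_ge1 d k t : 1 <= stretch d k t.
Proof. by rewrite /stretch le_max lexx. Qed.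

Lemma shrink_gt0 d k t : 0 < d < 1 -> 1 <= k -> 0 < shrink d k t.
Proof.
move=> /andP[d0 d1] k1; rewrite /shrink lt_min ltr01 /= subr_gt0.
rewrite invfM mulrCA gtr_pMr ?invr_gt0//.
have k0 : 0 < Num.max k t by rewrite lt_max (lt_le_trans ltr01 k1).
rewrite ltr_pdivrMr// mul1r lt_max; apply/orP; left; lra.
Qed.

Lemma stretchK d k t : 0 < d < 1 -> 1 <= k -> 0 <= t ->
  shrink d k (stretch d k t * t) * stretch d k t = 1.
Proof.
move=> /andP[d0 d1] k1 t0; rewrite /stretch.
have k0 : 0 < k by lra.
have /orP[t1|t1] := le_total t 1.
  rewrite (max_idPl t1) divr1 addrC subrK (max_idPr k1) /shrink.
  have kt : k * t <= k by rewrite ler_piMr// ltW.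
  rewrite (max_idPl kt) (_ : _ - _ = k^-1); last by field; rewrite !gt_eqF.
  by rewrite (min_idPr _) ?mulVf ?gt_eqF// invf_le1.
rewrite (max_idPr t1).
have t0' : 0 < t by lra.
(* In the first case t lies beyond the point where the piece of slope [d] meets the identity; then
   also k <= t, so both factors are 1. *)
have /orP[s1|s1] := le_total (d + (k - d) / t) 1.
  rewrite (max_idPl s1) mul1r mulr1 /shrink.
  have {}s1 : k - d <= (1 - d) * t by rewrite -ler_pdivrMr//; lra.
  have kt : k <= t by nra.
  rewrite (max_idPr kt); apply/min_idPl.
  rewrite lerBrDr -lerBrDl ler_pdivrMr ?mulr_gt0// mulrBl mulrA mulVf ?gt_eqF//.
  by lra.
rewrite (max_idPr s1); set s := d + _.
have st : s * t = d * t + (k - d) by rewrite /s mulrDl divfK// gt_eqF.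
have kst : k <= s * t by rewrite st; nra.
rewrite /shrink (max_idPr kst).
have s0 : 0 < s by rewrite /s; lra.
have -> : d^-1 - (k - d) / (d * (s * t)) = s^-1.
  have -> : k - d = s * t - d * t by rewrite st; ring.
  by field; rewrite !gt_eqF.
by rewrite (min_idPr _) ?mulVf ?gt_eqF// invf_le1.
Qed.

Lemma shrinkK d k t : 0 < d < 1 -> 1 <= k -> 0 <= t ->
  stretch d k (shrink d k t * t) * shrink d k t = 1.
Proof.
move=> /andP[d0 d1] k1 t0; rewrite /shrink.
have k0 : 0 < k by lra.
have /orP[tk|tk] := le_total t k.
  rewrite (max_idPl tk) (_ : d^-1 - _ = k^-1); last by field; rewrite !gt_eqF.
  have kV1 : k^-1 <= 1 by rewrite invf_le1.
  rewrite (min_idPr kV1) /stretch.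
  have kt1 : k^-1 * t <= 1 by rewrite ler_pdivrMl// mulr1.
  by rewrite (max_idPl kt1) divr1 addrC subrK (max_idPr k1) mulfV// gt_eqF.
rewrite (max_idPr tk).
have t0' : 0 < t by lra.
have -> : d^-1 - (k - d) / (d * t) = (t - k + d) / (d * t).
  by field; rewrite !gt_eqF.
have /orP[x1|x1] := le_total 1 ((t - k + d) / (d * t)).
  rewrite (min_idPl x1) mul1r mulr1 /stretch (max_idPr (le_trans k1 tk)).
  rewrite (max_idPl _)//.
  move: x1; rewrite ler_pdivlMr ?mulr_gt0// mul1r => x1.
  by rewrite -lerBrDl ler_pdivrMr// mulrBl; lra.
rewrite (min_idPr x1); set x := (_ / _).
have xt : x * t = (t - k + d) / d by rewrite /x; field; rewrite !gt_eqF.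
have xt1 : 1 <= x * t by rewrite xt ler_pdivlMr// mul1r; lra.
have x0 : 0 < x by rewrite divr_gt0 ?mulr_gt0//; lra.
rewrite /stretch (max_idPr xt1) xt.
have -> : d + (k - d) / ((t - k + d) / d) = x^-1.
  by rewrite /x; field; rewrite !gt_eqF//; lra.
by rewrite (max_idPr _) ?mulVf ?gt_eqF// invf_ge1.
Qed.

Lemma stretch_eq1 d t : 0 < d < 1 -> stretch d 1 t = 1.
Proof.
move=> /andP[d0 d1]; rewrite /stretch (max_idPl _)// -lerBrDl.
have m0 : 0 < Num.max 1 t by rewrite lt_max ltr01.
rewrite ler_pdivrMr// ler_peMr ?subr_ge0 ?(ltW d1)//.
by rewrite le_max lexx.
Qed.

(** A factor above 1 means (1 - d) a < a/b - d < a/b; dividing by a gives the claim. This confines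
    the moved points to the dilate of {b < 1} by 1/(1 - d). *)
Lemma stretch_neq1 d (a b : R) : 0 < d < 1 -> 0 <= b ->
  stretch d (Num.max 1 (a / b)) a != 1 -> (1 - d) * b < 1.
Proof.
move=> /[dup] d01 /andP[d0 d1] b0.
have [ab|] := boolP (a / b <= 1); first by rewrite (max_idPl ab) stretch_eq1// eqxx.
rewrite -ltNge => ab; have {}b0 : 0 < b.
  by rewrite lt_def b0 andbT; apply: contraTneq ab => ->; rewrite invr0 mulr0 ltr10.
have ba : b < a by move: ab; rewrite ltr_pdivlMr// mul1r.
rewrite (max_idPr (ltW ab)) /stretch => s1.
have m0 : 0 < Num.max 1 a by rewrite lt_max ltr01.
have : 1 < d + (a / b - d) / Num.max 1 a.
  by rewrite ltNge; apply: contra s1 => /max_idPl ->.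
rewrite -ltrBlDl ltr_pdivlMr// => h.
have : (1 - d) * a < a / b - d.
  apply: le_lt_trans h; rewrite ler_pM2l ?subr_gt0//.
  by rewrite le_max lexx orbT.
have a0 : 0 < a by lra.
have -> : a / b - d = (a - d * b) / b by field; rewrite gt_eqF.
rewrite ltr_pdivlMr// => h2.
rewrite -(ltr_pM2r a0); have : 0 < d * b by rewrite mulr_gt0.
lra.
Qed.

(** The union of {a < 1} and {b < 1} is {min(a, b) < 1}, and max(1, a/b) is a / min(a, b): for a < 1
    the factor turns the value of min(a, b) into that of a. For a >= 1 the new value of a is at
    least max(1, a/b), so that of b is at least 1 too. *)
Lemma stretch_inside d (a b : R) :
  0 < d < 1 -> 0 <= a -> 0 <= b -> (b = 0 -> a = 0) ->
  let s := stretch d (Num.max 1 (a / b)) a in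
  ((s * a < 1) || (s * b < 1)) = (a < 1).
Proof.
move=> /andP[d0 d1] a0 b0 ab s; rewrite {}/s.
set k := Num.max 1 (a / b).
have k1 : 1 <= k by rewrite /k le_max lexx.
have kb : k * b = Num.max b a.
  (* For b = 0, which forces a = 0, division by zero yields 0 and the formula still holds. *)
  rewrite /k maxr_pMl// mul1r; have [b00|bn] := eqVneq b 0.
    by rewrite (ab b00) b00 !mul0r.
  by rewrite divfK.
have [a1|] := boolP (a < 1).
  rewrite /stretch (max_idPl (ltW a1)) divr1 addrC subrK (max_idPr k1).
  have /orP[ka|ka] := le_total (a / b) 1.
    by rewrite /k (max_idPl ka) mul1r a1.
  have b0' : b != 0 by apply: contraTneq ka => ->; rewrite invr0 mulr0 ler10.
  rewrite kb (max_idPr _) ?a1 ?orbT//.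
  by move: ka; rewrite ler_pdivlMr ?mul1r// lt_def b0' b0.
rewrite -leNgt => a1.
apply/negbTE; rewrite negb_or -!leNgt.
have sk : k <= stretch d k a * a.
  rewrite /stretch (max_idPr a1) maxr_pMl//
    mulrDl divfK ?gt_eqF ?(lt_le_trans ltr01)//.
  by rewrite le_max; apply/orP; right; nra.
rewrite (le_trans k1 sk)/=.
have b0' : 0 < b.
  by rewrite lt_def b0 andbT; apply: contraTneq a1 => /ab ->; rewrite -ltNge ltr01.
have a0' : 0 < a by lra.
rewrite -(ler_pM2l a0') mulr1 mulrCA mulrA.
apply: (@le_trans _ _ (k * b)); first by rewrite kb le_max lexx orbT.
by rewrite ler_pM2r// .
Qed.

End radial_profile.

(** The gauge of a star-shaped neighbourhood {g < 1} of the origin: the Lipschitz bound keeps its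
    boundary away from 0, and the lower bound makes it bounded. *)
Definition gauge_like {R : realType} n (g : 'rV[R]_n -> R) :=
  [/\ exists L, lipschitz_with L setT (g : _ -> R^o),
      exists2 k, 0 < k & forall z, k * `|z| <= g z &
      forall t z, 0 <= t -> g (t *: z) = t * g z].

(* Exactly the condition under which the radial map [z |-> f z *: z] is
   Lipschitz. *)
Definition radially_lipschitz {R : realType} n (f : 'rV[R]_n -> R) :=
  exists2 C, 0 <= C & forall u v,
    `|f u| <= C /\ `|u| * `|f u - f v| <= C * `|u - v|.

Lemma dist_max_le {R : realDomainType} (x y x' y' : R) :
  `|Num.max x y - Num.max x' y'| <= `|x - x'| + `|y - y'|.
Proof.
rewrite !maxEle; case: ifPn => xy; case: ifPn => xy'.
- by rewrite lerDr.
- move: xy'; rewrite -ltNge => xy'.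
  rewrite ler_norml; apply/andP; split.
    have := ler_norm (- (x - x')); rewrite normrN; have := normr_ge0 (y - y'); lra.
  have := ler_norm (y - y'); have := normr_ge0 (x - x'); lra.
- move: xy; rewrite -ltNge => xy.
  rewrite ler_norml; apply/andP; split.
    have := ler_norm (- (y - y')); rewrite normrN; have := normr_ge0 (x - x'); lra.
  have := ler_norm (x - x'); have := normr_ge0 (y - y'); lra.
- by rewrite lerDl.
Qed.

(** * Lipschitz estimates for radial factors *)

Section radial_lipschitz.
Context {R : realType} (n : nat).
Implicit Types (f g a b : 'rV[R]_n -> R) (u v z : 'rV[R]_n).

Lemma gauge_like0 a : gauge_like a -> a 0 = 0.
Proof. by case=> _ _ /(_ 0 0 (lexx _)); rewrite scale0r mul0r. Qed.

Lemma gauge_likeP a : gauge_like a -> exists L k : R, [/\ 0 < L, 0 < k,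
  forall u v, `|a u - a v| <= L * `|u - v|, forall u, k * `|u| <= a u &
  forall u, a u <= L * `|u|].
Proof.
move=> ga; have [[L aL] [k k0 ka] _] := ga.
have aL' u v : `|a u - a v| <= (`|L| + 1) * `|u - v|.
  by rewrite (le_trans (aL u v I I))// ler_wpM2r// (le_trans (ler_norm _))// lerDl.
exists (`|L| + 1), k; split => //.
move=> u; have := aL' u 0; rewrite (gauge_like0 ga) !subr0.
exact: le_trans (ler_norm _).
Qed.

Lemma gauge_like_ge0 a z : gauge_like a -> 0 <= a z.
Proof.
by case=> _ [k k0 ka] _; rewrite (le_trans _ (ka z))// mulr_ge0// ltW.
Qed.

Lemma gauge_like_gt0 a z : gauge_like a -> z != 0 -> 0 < a z.
Proof.
by case=> _ [k k0 ka] _ z0; rewrite (lt_le_trans _ (ka z))// mulr_gt0// normr_gt0.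
Qed.

Lemma gauge_like_eq0 a b z : gauge_like a -> gauge_like b -> b z = 0 -> a z = 0.
Proof.
move=> ga gb; have [->|z0] := eqVneq z 0; first by rewrite !gauge_like0.
by move=> bz; have := gauge_like_gt0 gb z0; rewrite bz ltxx.
Qed.

Lemma radially_lipschitz_cst (c : R) : radially_lipschitz (cst c : 'rV[R]_n -> R).
Proof.
by exists `|c| => // u v; split => //=; rewrite subrr normr0 mulr0 mulr_ge0.
Qed.

Lemma radially_lipschitzD f g : radially_lipschitz f -> radially_lipschitz g ->
  radially_lipschitz (fun z => f z + g z).
Proof.
move=> [C C0 fC] [D D0 gD]; exists (C + D); first exact: addr_ge0.
move=> u v; have [f1 f2] := fC u v; have [g1 g2] := gD u v; split.
  by rewrite (le_trans (ler_normD _ _))// lerD.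
rewrite mulrDl opprD addrACA (le_trans _ (lerD f2 g2))// -mulrDr.
by rewrite ler_wpM2l// ler_normD.
Qed.

Lemma radially_lipschitzM f g : radially_lipschitz f -> radially_lipschitz g ->
  radially_lipschitz (fun z => f z * g z).
Proof.
move=> [C C0 fC] [D D0 gD]; exists (C * D + C * D).
  by rewrite addr_ge0// mulr_ge0.
move=> u v; have [f1 f2] := fC u v; have [g1 g2] := gD u v; split.
  by rewrite normrM (le_trans (ler_pM _ _ f1 g1))// lerDl mulr_ge0.
have g3 := (gD v u).1.
have -> : f u * g u - f v * g v = f u * (g u - g v) + (f u - f v) * g v by ring.
apply: (@le_trans _ _ (`|f u| * (`|u| * `|g u - g v|) + (`|u| * `|f u - f v|) * `|g
  v|)).
  rewrite mulrCA -mulrA -mulrDr -!normrM.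
  by rewrite ler_wpM2l// ler_normD.
rewrite mulrDl lerD//.
  by rewrite -mulrA ler_pM// mulr_ge0.
by rewrite [leRHS]mulrAC ler_pM// mulr_ge0.
Qed.

Lemma radially_lipschitzN f :
  radially_lipschitz f -> radially_lipschitz (fun z => - f z).
Proof.
move=> /(radially_lipschitzM (radially_lipschitz_cst (-1))) [C C0 fC].
exists C => // u v; have [] := fC u v;
  rewrite /= -mulrBr !normrM normrN1 !mul1r normrN.
by move=> h1 h2; split => //; rewrite opprK addrC distrC.
Qed.

Lemma radially_lipschitz_max f g : radially_lipschitz f -> radially_lipschitz g ->
  radially_lipschitz (fun z => Num.max (f z) (g z)).
Proof.
move=> [C C0 fC] [D D0 gD]; exists (C + D); first exact: addr_ge0.
move=> u v; have [f1 f2] := fC u v; have [g1 g2] := gD u v; split.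
  rewrite maxEle; case: ifP => _; first by rewrite (le_trans g1)// lerDr.
  by rewrite (le_trans f1)// lerDl.
rewrite mulrDl (le_trans _ (lerD f2 g2))// -mulrDr ler_wpM2l//.
exact: dist_max_le.
Qed.

(** The quotient need not be continuous at 0. Away from 0, the difference of two values is a
    Lipschitz term divided by b(u), and the weight |u| cancels that denominator up to the lower
    gauge constant of [b]. *)
Lemma radially_lipschitz_ratio a b : gauge_like a -> gauge_like b ->
  radially_lipschitz (fun z => a z / b z).
Proof.
move=> ga gb; have [La [ka [La0 ka0 aL ak aU]]] := gauge_likeP ga.
have [Lb [kb [Lb0 kb0 bL bk bU]]] := gauge_likeP gb.
have bd u : `|a u / b u| <= La / kb.
  have [->|u0] := eqVneq u 0.
    by rewrite (gauge_like0 ga) mul0r normr0 divr_ge0// ltW.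
  have bu := gauge_like_gt0 gb u0; have au := gauge_like_gt0 ga u0.
  rewrite ger0_norm; last by rewrite divr_ge0// ltW.
  rewrite ler_pdivrMr// (le_trans (aU u))//.
  rewrite -mulrA ler_pM2l// ler_pdivlMl//.
have ? := ltW La0; have ? := ltW Lb0; have ? := ltW ka0; have ? := ltW kb0.
pose P := La / kb; have P0 : 0 <= P by rewrite divr_ge0.
pose Q := (La + P * Lb) / kb.
have Q0 : 0 <= Q by rewrite divr_ge0// addr_ge0// mulr_ge0.
have C0 : 0 <= P + P + Q by lra.
exists (P + P + Q) => // u v; split; first by rewrite (le_trans (bd u))// -/P; lra.
have [->|u0] := eqVneq u 0; first by rewrite normr0 mul0r mulr_ge0.
have [->|v0] := eqVneq v 0.
  rewrite subr0 mulrC ler_wpM2r//.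
  apply: (@le_trans _ _ (P + P));
    first by rewrite (le_trans (ler_normB _ _))// lerD.
  by lra.
have bu := gauge_like_gt0 gb u0; have bv := gauge_like_gt0 gb v0.
have au := gauge_like_gt0 ga u0; have av := gauge_like_gt0 ga v0.
have e : a u / b u - a v / b v = ((a u - a v) - (a v / b v) * (b u - b v)) / b u.
  by field; rewrite !gt_eqF.
rewrite e normrM normfV (gtr0_norm bu).
apply: (@le_trans _ _ (kb^-1 * ((La + P * Lb) * `|u - v|))); last first.
  by rewrite mulrA [kb^-1 * _]mulrC ler_wpM2r// -/Q; lra.
rewrite mulrCA mulrC ler_pM//; first by rewrite mulr_ge0// invr_ge0 ltW.
  by rewrite ler_pdivrMr// ler_pdivlMl.
rewrite (le_trans (ler_normB _ _))// mulrDl lerD// normrM -mulrA.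
by rewrite ler_pM.
Qed.

(** With m = max(f, a), the difference of inverses has denominator m(u) m(v). Since m >= 1 and |u|
    <= m(u)/k, one factor absorbs the weight |u| in the part coming from [a], while the part from
    [f] is weighted already. *)
Lemma radially_lipschitz_invmax f a :
  radially_lipschitz f -> (forall z, 1 <= f z) ->
  gauge_like a -> radially_lipschitz (fun z => (Num.max (f z) (a z))^-1).
Proof.
move=> [C C0 fC] f1 ga; have [L [k [L0 k0 aL ak aU]]] := gauge_likeP ga.
pose m z := Num.max (f z) (a z).
have m1 z : 1 <= m z by rewrite le_max f1.
have m0 z : 0 < m z by rewrite (lt_le_trans ltr01).
have dm u v : `|m u - m v| <= `|f u - f v| + `|a u - a v| by exact: dist_max_le.
have ? := ltW L0; have ? := ltW k0.
have Lk0 : 0 <= L / k by rewrite divr_ge0.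
exists (1 + C + L / k) => [|u v]; first by rewrite !addr_ge0.
split.
  have mV : 0 < (m u)^-1 by rewrite invr_gt0.
  rewrite (gtr0_norm mV).
  have : (m u)^-1 <= 1 by rewrite invf_le1.
  by move=> h; rewrite -/(m u) (le_trans h)// -addrA lerDl addr_ge0.
have mE z : Num.max (f z) (a z) = m z by [].
rewrite /= !mE; have -> : (m u)^-1 - (m v)^-1 = (m v - m u) / (m u * m v) by field;
  rewrite !gt_eqF.
rewrite normrM normfV (gtr0_norm (mulr_gt0 (m0 u) (m0 v))) distrC mulrA ler_pdivrMr
  ?mulr_gt0//.
have fuv := (fC u v).2; have auv := aL u v.
have um : `|u| <= m u / k.
  by rewrite ler_pdivlMr// mulrC (le_trans (ak u))// /m le_max lexx orbT.
apply: (@le_trans _ _ ((C + L / k) * `|u - v| * m u)).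
  rewrite (le_trans (ler_wpM2l _ (dm u v)))// mulrDr !mulrDl lerD//.
    by rewrite (le_trans fuv)// ler_peMr// mulr_ge0.
  apply: (@le_trans _ _ (m u / k * (L * `|u - v|))); first by rewrite ler_pM.
  by rewrite le_eqVlt; apply/orP; left; apply/eqP; ring.
apply: ler_pM; first by rewrite mulr_ge0// addr_ge0.
- exact: ltW.
- by rewrite ler_wpM2r//; lra.
- by rewrite ler_peMr// ltW.
Qed.

Lemma radial_map_lipschitz f : radially_lipschitz f ->
  exists L, lipschitz_with L setT (fun z => f z *: z).
Proof.
move=> [C C0 fC]; exists (C + C) => u v _ _.
have -> : f u *: u - f v *: v = (f u - f v) *: u + f v *: (u - v).
  by rewrite scalerBl scalerBr addrA subrK.
rewrite (le_trans (ler_normD _ _))// !normrZ mulrDl lerD//.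
  by rewrite mulrC (fC u v).2.
by rewrite ler_wpM2r// (fC v u).1.
Qed.

End radial_lipschitz.

Definition gauge_ratio {R : realType} n (a b : 'rV[R]_n -> R) (z : 'rV[R]_n) : R :=
  Num.max 1 (a z / b z).

Definition gauge_stretch {R : realType} n (d : R) (a b : 'rV[R]_n -> R)
  (z : 'rV[R]_n) : 'rV[R]_n := stretch d (gauge_ratio a b z) (a z) *: z.

Definition gauge_shrink {R : realType} n (d : R) (a b : 'rV[R]_n -> R)
  (z : 'rV[R]_n) : 'rV[R]_n := shrink d (gauge_ratio a b z) (a z) *: z.

Section gauge_stretch_theory.
Context {R : realType} (n : nat).
Implicit Types (a b f : 'rV[R]_n -> R) (u v w z : 'rV[R]_n) (d t : R).

Lemma gauge_ratio_ge1 a b z : 1 <= gauge_ratio a b z.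
Proof. by rewrite le_max lexx. Qed.

Lemma gauge_ratioZ a b t z : gauge_like a -> gauge_like b -> 0 < t ->
  gauge_ratio a b (t *: z) = gauge_ratio a b z.
Proof.
move=> [_ _ aZ] [_ _ bZ] t0; rewrite /gauge_ratio aZ ?bZ ?(ltW t0)//.
by rewrite -mulf_div mulfV ?gt_eqF// mul1r.
Qed.

Lemma gauge_stretchK a b d : gauge_like a -> gauge_like b -> 0 < d < 1 ->
  cancel (gauge_stretch d a b) (gauge_shrink d a b).
Proof.
move=> ga gb d01 z; have [_ _ aZ] := ga.
have s1 := stretch_ge1 d (gauge_ratio a b z) (a z).
have s0 := lt_le_trans ltr01 s1.
rewrite /gauge_shrink /gauge_stretch gauge_ratioZ// aZ ?(ltW s0)// scalerA.
by rewrite stretchK ?scale1r ?gauge_ratio_ge1 ?gauge_like_ge0.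
Qed.

Lemma gauge_shrinkK a b d : gauge_like a -> gauge_like b -> 0 < d < 1 ->
  cancel (gauge_shrink d a b) (gauge_stretch d a b).
Proof.
move=> ga gb d01 z; have [_ _ aZ] := ga.
have s0 := shrink_gt0 (a z) d01 (gauge_ratio_ge1 a b z).
rewrite /gauge_stretch /gauge_shrink gauge_ratioZ// aZ ?(ltW s0)// scalerA.
by rewrite shrinkK ?scale1r ?gauge_ratio_ge1 ?gauge_like_ge0.
Qed.

Lemma gauge_stretch_lipschitz a b d : gauge_like a -> gauge_like b ->
  exists L, lipschitz_with L setT (gauge_stretch d a b).
Proof.
move=> ga gb; apply: radial_map_lipschitz.
apply: radially_lipschitz_max; first exact: radially_lipschitz_cst.
apply: radially_lipschitzD; first exact: radially_lipschitz_cst.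
apply: radially_lipschitzM.
  apply: radially_lipschitzD; last exact: radially_lipschitz_cst.
  apply: radially_lipschitz_max; first exact: radially_lipschitz_cst.
  exact: radially_lipschitz_ratio.
by apply: (@radially_lipschitz_invmax _ _ (cst 1)) => //;
  exact: radially_lipschitz_cst.
Qed.

Lemma minEN (x y : R) : Num.min x y = - Num.max (- x) (- y).
Proof. by rewrite oppr_max !opprK. Qed.

Lemma gauge_shrink_lipschitz a b d : gauge_like a -> gauge_like b ->
  exists L, lipschitz_with L setT (gauge_shrink d a b).
Proof.
move=> ga gb; apply: radial_map_lipschitz.
have rr : radially_lipschitz (gauge_ratio a b).
  apply: radially_lipschitz_max; first exact: radially_lipschitz_cst.
  exact: radially_lipschitz_ratio.
rewrite /shrink; under eq_fun do rewrite minEN.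
apply/radially_lipschitzN/radially_lipschitz_max;
  first exact: radially_lipschitz_cst.
apply/radially_lipschitzN/radially_lipschitzD; first exact: radially_lipschitz_cst.
apply/radially_lipschitzN/radially_lipschitzM.
  by apply: radially_lipschitzD => //; exact: radially_lipschitz_cst.
under eq_fun do rewrite invfM.
apply: radially_lipschitzM; first exact: radially_lipschitz_cst.
by apply: radially_lipschitz_invmax => // z; exact: gauge_ratio_ge1.
Qed.

Lemma gauge_stretch_inside a b d z : gauge_like a -> gauge_like b -> 0 < d < 1 ->
  ((a (gauge_stretch d a b z) < 1) || (b (gauge_stretch d a b z) < 1)) = (a z < 1).
Proof.
move=> ga gb d01; have [_ _ aZ] := ga; have [_ _ bZ] := gb.
have s0 := ltW (lt_le_trans ltr01 (stretch_ge1 d (gauge_ratio a b z) (a z))).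
rewrite /gauge_stretch aZ// bZ// stretch_inside ?gauge_like_ge0//.
exact: gauge_like_eq0.
Qed.

(** This locality is what lets a new ball be attached without disturbing those already placed. *)
Lemma gauge_stretch_moved a b d z : gauge_like b -> 0 < d < 1 ->
  gauge_stretch d a b z != z -> (1 - d) * b z < 1.
Proof.
move=> gb d01 Fz; apply: (@stretch_neq1 _ d (a z)) => //;
  first exact: gauge_like_ge0.
by apply: contra Fz => /eqP s1; rewrite /gauge_stretch /gauge_ratio s1 scale1r.
Qed.

(* A surface meeting each ray at most once is a Lipschitz image of the
   hyperplane [dot w v = 1], by central projection. *)
Lemma radial_graph_null w (h : 'rV[R]_n -> R) : w != 0 ->
  (forall t z, 0 < t -> h (t *: z) = h z / t) ->
  (exists2 C, 0 <= C & forall u v, u != 0 -> v != 0 ->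
     `|u| * `|h u *: u - h v *: v| <= C * `|u - v|) ->
  lipschitz_null [set z | 0 < dot w z /\ h z = 1].
Proof.
move=> w0 hZ [C C0 hC].
have w1 : 0 < enorm w by rewrite lt_def enorm_eq0 w0 enorm_ge0.
pose E := [set v | dot w v = 1].
(* The hyperplane stays away from the origin, so the estimate weighted by |u| becomes an honest
   Lipschitz bound on it. *)
have En v : E v -> 1 <= enorm w * n%:R * `|v|.
  move=> Ev; rewrite -[leLHS]Ev (le_trans (dot_le_enorm _ _))// -mulrA.
  by rewrite ler_pM2l// enorm_le_norm.
have E0 v : E v -> v != 0.
  by move=> /En; apply: contraTneq => ->; rewrite normr0 mulr0 -ltNge ltr01.
apply: (@lipschitz_nullS _ _ _ ((fun v => h v *: v) @` E)).
  move=> z [wz hz]; exists ((dot w z)^-1 *: z).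
    by rewrite /E/= dotZr mulVf ?gt_eqF.
  by rewrite hZ ?invr_gt0// hz mul1r invrK scalerA mulfV ?scale1r ?gt_eqF.
apply: (@hyperplane_lipschitz_null _ _ w 1 (enorm w * n%:R * C)) => // u v Eu Ev.
have := hC u v (E0 u Eu) (E0 v Ev); have := En u Eu.
set x := `|u|; set y := `|_ - _|; set D := `|_ - _| => ux xD.
have wn : 0 <= enorm w * n%:R by rewrite mulr_ge0// enorm_ge0.
rewrite -mulrA (le_trans _ (ler_wpM2l wn xD))// mulrA ler_peMl//.
exact: normr_ge0.
Qed.

(** The map u -> u / a(u) is the central projection onto {a = 1}, homogeneous of degree 0; its
    Lipschitz constant near u can only be of order 1/|u|, hence the weight. *)
Lemma inv_gauge_graph a : gauge_like a -> exists2 C, 0 <= C &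
  forall u v, u != 0 -> v != 0 ->
    `|u| * `|(a u)^-1 *: u - (a v)^-1 *: v| <= C * `|u - v|.
Proof.
move=> ga; have [L [k [L0 k0 aL ak aU]]] := gauge_likeP ga.
have kV : 0 < k^-1 by rewrite invr_gt0.
have [? ?] := (ltW kV, ltW L0).
exists (k^-1 + k^-1 * (k^-1 * L)) => [|u v u0 v0].
  by rewrite addr_ge0// !mulr_ge0.
have au := gauge_like_gt0 ga u0; have av := gauge_like_gt0 ga v0.
have uk z : z != 0 -> `|z| * (a z)^-1 <= k^-1.
  by move=> z0; rewrite ler_pdivrMr ?gauge_like_gt0// ler_pdivlMl.
have -> : (a u)^-1 *: u - (a v)^-1 *: v =
    (a u)^-1 *: (u - v) + ((a u)^-1 * ((a v)^-1 * (a v - a u))) *: v.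
  rewrite scalerBr -addrA; congr (_ + _).
  have -> : (a u)^-1 * ((a v)^-1 * (a v - a u)) = (a u)^-1 - (a v)^-1.
    by field; rewrite !gt_eqF.
  by rewrite scalerBl addrA addNr add0r.
apply: (@le_trans _ _ (`|u| * ((a u)^-1 * `|u - v| +
    (a u)^-1 * ((a v)^-1 * (L * `|u - v|)) * `|v|))).
  rewrite ler_wpM2l// (le_trans (ler_normD _ _))// !normrZ !normfV.
  rewrite (gtr0_norm au) (gtr0_norm av) lerD2l ler_wpM2r//
    ler_wpM2l ?invr_ge0 ?(ltW au)//.
  by rewrite ler_wpM2l ?invr_ge0 ?(ltW av)// distrC.
rewrite mulrDr mulrDl lerD//; first by rewrite mulrA ler_wpM2r// uk.
have -> : `|u| * ((a u)^-1 * ((a v)^-1 * (L * `|u - v|)) * `|v|) =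
    (`|u| * (a u)^-1) * ((`|v| * (a v)^-1) * (L * `|u - v|)) by ring.
rewrite -!mulrA [leLHS]mulrA [X in _ * X <= _]mulrA.
by rewrite ler_pM ?ler_pM ?uk ?mulr_ge0 ?invr_ge0 ?(ltW au) ?(ltW av).
Qed.

End gauge_stretch_theory.

(** * Positivity of the Jacobian of the stretching *)

Section gauge_stretch_bilip.
Context {R : realType} (n : nat).
Implicit Types (a b s : 'rV[R]_n -> R) (z w : 'rV[R]_n).

(* Euler's relation, in the form needed for an affine function of a
   (-1)-homogeneous one. *)
Lemma derive_radial s z (d : R) : differentiable s z ->
  (forall t, 0 < t -> s (t *: z) = d + (s z - d) / t) -> 'D_z s z = d - s z.
Proof.
move=> ds sZ; pose h (k : nat) : R := k.+1%:R^-1.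
have h_gt0 k : 0 < h k by rewrite invr_gt0.
have h0 : h @ \oo --> (0 : R) := cvg_harmonic.
have c1 : diff_quot z s (h k) z @[k --> \oo] --> 'D_z s z.
  by apply: diff_quot_cvg => // [|k]; [exact: diff_derivable|rewrite gt_eqF].
have c2 : diff_quot z s (h k) z @[k --> \oo] --> (d - s z) * (1 + 0)^-1.
  have -> : (fun k => diff_quot z s (h k) z) = (fun k => (d - s z) * (1 + h k)^-1).
    apply/funext => k; have hk := h_gt0 k; rewrite /diff_quot.
    have -> : h k *: z + z = (1 + h k) *: z by rewrite scalerDl scale1r addrC.
    by rewrite sZ; [field; rewrite !gt_eqF// addr_gt0|rewrite addr_gt0].
  apply: cvgMr; apply: cvgV; first by rewrite addr0 oner_eq0.
  by apply: cvgD => //; exact: cvg_cst.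
by rewrite -(cvg_lim _ c1)// (cvg_lim _ c2)// addr0 invr1 mulr1.
Qed.

Lemma radial_local_jacobian (F : 'rV[R]_n -> 'rV[R]_n) s z :
  (\forall y \near z, F y = s y *: y) -> differentiable s z ->
  0 < s z -> 0 < s z + 'D_z s z ->
  differentiable F z /\ 0 < \det ('J F z).
Proof.
move=> Fs ds s0 sD0; have [dG JG] := radial_jacobian ds s0 sD0.
have sF : \forall y \near z, s y *: y = F y by apply: filterS Fs => y ->.
split; first exact: near_eq_differentiable sF dG.
by have -> : 'J F z = 'J (fun y => s y *: y) z by exact: near_eq_jacobian sF dG.
Qed.

Lemma near_lt (f : 'rV[R]_n -> R) z (c : R) : {for z, continuous f} -> f z < c ->
  \forall y \near z, f y < c.
Proof. by move=> cf fc; exact: (cf _ (lt_nbhsl fc)). Qed.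

Lemma near_gt (f : 'rV[R]_n -> R) z (c : R) : {for z, continuous f} -> c < f z ->
  \forall y \near z, c < f y.
Proof. by move=> cf fc; exact: (cf _ (lt_nbhsr fc)). Qed.

Lemma gauge_continuous a : gauge_like a -> continuous a.
Proof. by case=> [[L aL] _ _]; exact: (lipschitz_with_continuous aL). Qed.

Lemma dot_continuous w : continuous (dot w : 'rV[R]_n -> R).
Proof.
apply: (@lipschitz_with_continuous _ 'rV[R]_n R^o (enorm w * n%:R)) => u v _ _.
rewrite -dotNr -dotDr (le_trans (normr_dot_le _ _))// -mulrA ler_wpM2l ?enorm_ge0//.
exact: enorm_le_norm.
Qed.

(** Off [Z1], [Z2] and [Z3] each maximum in the factor is attained by a single branch near z, so the
    factor is locally 1, a/b or d + 1/b - d/a; each has a positive radial slope. *)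
Theorem gauge_stretch_bilip_qc a b w (d : R) : gauge_like a -> gauge_like b ->
  (forall z, z != 0 -> differentiable a z) ->
  (forall z, z != 0 -> differentiable b z) ->
  w != 0 -> (forall z, dot w z <= 0 -> a z <= b z) ->
  (forall z, 0 < dot w z -> b z < a z) -> 0 < d < 1 ->
  bilip_qc (gauge_stretch d a b).
Proof.
move=> ga gb da db w0 ab ba /[dup] d01 /andP[d0 d1].
have [L FL] := gauge_stretch_lipschitz d ga gb.
have [M GM] := gauge_shrink_lipschitz d ga gb.
have d1' : 0 < 1 - d by lra.
(* If f = d + 1/b - d/a is the branch outside A, then h = (f - d)/(1 - d). It equals 1 exactly where
   f does and, unlike f, is homogeneous of degree -1, as [radial_graph_null] requires. *)
pose h z := ((b z)^-1 - d * (a z)^-1) / (1 - d).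
pose Z1 := [set z : 'rV[R]_n | dot w z = 0].
pose Z2 := [set z : 'rV[R]_n | 0 < dot w z /\ (a z)^-1 = 1].
pose Z3 := [set z : 'rV[R]_n | 0 < dot w z /\ h z = 1].
have [_ _ aZ] := ga; have [_ _ bZ] := gb.
have n1 : lipschitz_null Z1.
  rewrite -(image_id Z1); apply: (@hyperplane_lipschitz_null _ _ w 0 1) => //
    x y _ _.
  by rewrite mul1r.
have n2 : lipschitz_null Z2.
  apply: radial_graph_null => //; last exact: inv_gauge_graph.
  by move=> t z t0; rewrite aZ ?(ltW t0)// invfM mulrC.
have n3 : lipschitz_null Z3.
  apply: radial_graph_null => //.
    by move=> t z t0; rewrite /h aZ ?bZ ?(ltW t0)// !invfM; ring.
  have [Ca Ca0 hCa] := inv_gauge_graph ga; have [Cb Cb0 hCb] := inv_gauge_graph gb.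
  have Cab : 0 <= (Cb + d * Ca) / (1 - d).
    by apply: divr_ge0; [apply: addr_ge0 => //; apply: mulr_ge0 => //|]; exact: ltW.
  exists ((Cb + d * Ca) / (1 - d)) => //.
  move=> u v u0 v0.
  have -> : h u *: u - h v *: v = (1 - d)^-1 *: (((b u)^-1 *: u - (b v)^-1 *: v)
      - d *: ((a u)^-1 *: u - (a v)^-1 *: v)).
    rewrite /h ![_ / (1 - d)]mulrC -!scalerA -scalerBr; congr (_ *: _).
    by rewrite !scalerBl scalerBr !scalerA !opprB addrACA [RHS]addrACA;
      congr (_ + _); rewrite addrC.
  rewrite normrZ normfV (gtr0_norm d1') mulrCA [leRHS]mulrAC mulrC ler_wpM2r
    ?invr_ge0 ?(ltW d1')//.
  apply: (@le_trans _ _ (`|u| * (`|(b u)^-1 *: u - (b v)^-1 *: v| +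
      d * `|(a u)^-1 *: u - (a v)^-1 *: v|))).
    rewrite ler_wpM2l// (le_trans (ler_normB _ _))// normrZ gtr0_norm//.
  by rewrite mulrDr mulrDl lerD ?hCb// mulrCA -mulrA ler_wpM2l ?(ltW d0)// hCa.
exists (gauge_shrink d a b), (Num.max L M), (Z1 `|` (Z2 `|` Z3)); split.
- exact: gauge_stretchK.
- exact: gauge_shrinkK.
- by apply: lipschitz_with_ge FL; rewrite le_max lexx.
- by apply: lipschitz_with_ge GM; rewrite le_max lexx orbT.
split; first by do 2?apply: lipschitz_nullU.
move=> z /not_orP[Z1z /not_orP[Z2z Z3z]].
have ca := gauge_continuous ga;
  have cw : continuous (dot w : 'rV[R]_n -> R) by exact: dot_continuous.
have id1 : 0 < 1 + 'D_z (cst 1 : 'rV[R]_n -> R) z.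
  by have -> := derive_cst (1 : R) z z; rewrite addr0.
have dc1 : differentiable (cst 1 : 'rV[R]_n -> R) z := differentiable_cst _ _.
have [wz|wz] := boolP (dot w z < 0).
  apply: (radial_local_jacobian _ dc1 ltr01 id1).
  have nw := near_lt (cw z) wz; apply: filterS nw => y wy.
  rewrite /gauge_stretch /gauge_ratio (max_idPl _) ?stretch_eq1//.
  have [b0|b0] := eqVneq (b y) 0; first by rewrite b0 invr0 mulr0.
  by rewrite ler_pdivrMr ?mul1r ?ab ?(ltW wy)// lt_def b0 gauge_like_ge0.
have {}wz : 0 < dot w z.
  by rewrite lt_def leNgt wz andbT; apply/eqP.
have z0 : z != 0.
  by apply: contraTneq wz => ->; rewrite -(scale0r (0 : 'rV[R]_n)) dotZr mul0r ltxx.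
have [az bz] := (gauge_like_gt0 ga z0, gauge_like_gt0 gb z0).
have dia : differentiable (fun y => (a y)^-1) z by apply: differentiableV => //;
  [exact: da|rewrite gt_eqF].
have dib : differentiable (fun y => (b y)^-1) z by apply: differentiableV => //;
  [exact: db|rewrite gt_eqF].
have nearw : \forall y \near z, [/\ 0 < a y, 0 < b y & gauge_ratio a b y = a y / b
  y].
  have nw := near_gt (cw z) wz; apply: filterS nw => y wy.
  have y0 : y != 0.
    by apply: contraTneq wy => ->;
      rewrite -(scale0r (0 : 'rV[R]_n)) dotZr mul0r ltxx.
  have [ay by_] := (gauge_like_gt0 ga y0, gauge_like_gt0 gb y0).
  split => //; rewrite /gauge_ratio (max_idPr _)//.
  by rewrite ler_pdivlMr// mul1r ltW// ba.
(* Inside A the factor is a/b, homogeneous of degree 0: its radial derivative vanishes and the slope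
   is a/b itself. *)
have [a1|a1] := boolP (a z < 1).
  pose s y := a y * (b y)^-1.
  have ds : differentiable s z by apply: differentiableM => //; exact: da.
  have sz0 : 0 < s z by rewrite divr_gt0.
  have sD : 'D_z s z = s z - s z.
    apply: derive_radial => // t t0; rewrite /s aZ ?bZ ?(ltW t0)//.
    by field; rewrite !gt_eqF.
  apply: (@radial_local_jacobian _ s) => //; last by rewrite sD subrr addr0.
  have na := near_lt (ca z) a1.
  apply: filterS2 na nearw => y ay [ay0 by0 ry].
  rewrite /gauge_stretch ry /stretch (max_idPl (ltW ay)) divr1 addrC subrK
    (max_idPr _)//.
  by rewrite -ry gauge_ratio_ge1.
have {}a1 : 1 < a z.
  rewrite lt_def leNgt a1 andbT; apply/eqP => a1'; apply: Z2z; split => //.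
  by rewrite a1' invr1.
have na := near_gt (ca z) a1.
(* Outside A the factor is max(1, f). Since f - d is homogeneous of degree -1, the slope f + D_z f
   is the constant [d]. *)
pose f y := d + ((b y)^-1 - d * (a y)^-1).
have df : differentiable f z.
  apply: (@differentiableD _ _ _ (cst d) (fun y => (b y)^-1 - d * (a y)^-1)) => //.
  apply: (@differentiableB _ _ _ (fun y => (b y)^-1) (fun y => d * (a y)^-1)) => //.
  exact: (@differentiableZ _ _ _ (fun y => (a y)^-1 : R^o)).
have cf : {for z, continuous f} := differentiable_continuous df.
have near1 : \forall y \near z, 1 < a y /\ gauge_stretch d a b y = Num.max 1 (f y)
  *: y.
  apply: filterS2 na nearw => y ay [ay0 by0 ry]; split => //.
  rewrite /gauge_stretch ry /stretch (max_idPr (ltW ay)); congr (Num.max _ _ *: _).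
  by rewrite /f; field; rewrite !gt_eqF.
have [f1|f1] := boolP (f z < 1).
  apply: (radial_local_jacobian _ dc1 ltr01 id1).
  have nf := near_lt cf f1.
  by apply: filterS2 nf near1 => y fy [_ ->]; rewrite (max_idPl (ltW fy)).
have {}f1 : 1 < f z.
  rewrite lt_def leNgt f1 andbT; apply/eqP => f1'; apply: Z3z; split => //.
  have -> : h z = (f z - d) / (1 - d) by rewrite /h /f; congr (_ / _); ring.
  by rewrite f1' mulfV// gt_eqF.
have sD : 'D_z f z = d - f z.
  apply: derive_radial => // t t0; rewrite /f aZ ?bZ ?(ltW t0)//.
  by field; rewrite !gt_eqF.
apply: (@radial_local_jacobian _ f) => //; [|lra|by rewrite sD; lra].
have nf := near_gt cf f1.
by apply: filterS2 nf near1 => y fy [_ ->]; rewrite (max_idPr (ltW fy)).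
Qed.

End gauge_stretch_bilip.

(** * Chains of balls *)

(* The Minkowski gauge of the ball [{z | |z|^2 - 2 c.z < 1}] of centre [c],
   whose boundary is at power [-1] from the origin. *)
Definition ball_gauge {R : realType} n (c z : 'rV[R]_n) : R :=
  Num.sqrt (dot c z ^+ 2 + dot z z) - dot c z.

Section ball_gauge_theory.
Context {R : realType} (n : nat).
Implicit Types (c z u v w : 'rV[R]_n).

Lemma hypot_dist (x y x' y' : R) : 0 <= y -> 0 <= y' ->
  Num.sqrt (x ^+ 2 + y ^+ 2) <= Num.sqrt (x' ^+ 2 + y' ^+ 2) + (`|x - x'| + `|y -
    y'|).
Proof.
move=> y0 y0'; set S := Num.sqrt (x' ^+ 2 + y' ^+ 2).
have S0 : 0 <= S by exact: sqrtr_ge0.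
have SS : S ^+ 2 = x' ^+ 2 + y' ^+ 2 by rewrite sqr_sqrtr// addr_ge0// sqr_ge0.
have D0 := normr_ge0 (x - x'); have E0 := normr_ge0 (y - y').
rewrite -(ler_pXn2r (n := 2))// ?nnegrE ?sqrtr_ge0 ?addr_ge0//.
rewrite sqr_sqrtr ?addr_ge0 ?sqr_ge0//.
have Dx : `|x - x'| ^+ 2 = (x - x') ^+ 2 by rewrite real_normK ?num_real.
have Dy : `|y - y'| ^+ 2 = (y - y') ^+ 2 by rewrite real_normK ?num_real.
have xS : x' * (x - x') <= S * `|x - x'|.
  rewrite (le_trans (ler_norm _))// normrM ler_wpM2r//.
  by rewrite -sqrtr_sqr ler_wsqrtr// lerDl sqr_ge0.
have yS : y' * (y - y') <= S * `|y - y'|.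
  rewrite (le_trans (ler_norm _))// normrM ler_wpM2r//.
  by rewrite -sqrtr_sqr ler_wsqrtr// lerDr sqr_ge0.
have := mulr_ge0 D0 E0.
move: xS yS Dx Dy; move: (`|x - x'|) (`|y - y'|) => D E xS yS Dx Dy DE.
have -> : (S + (D + E)) ^+ 2 = S ^+ 2 + 2 * (S * D) + 2 * (S * E) + D ^+ 2 + E ^+ 2
  + 2 * (D * E).
  by ring.
by rewrite SS Dx Dy; lra.
Qed.

Lemma ball_gauge_like c : gauge_like (ball_gauge c).
Proof.
have gE z : ball_gauge c z = Num.sqrt (dot c z ^+ 2 + enorm z ^+ 2) - dot c z.
  by rewrite enorm_sqr.
split.
- exists (n%:R * (enorm c + 1 + enorm c)) => u v _ _.
  have dc x y : `|dot c x - dot c y| <= enorm c * enorm (x - y).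
    by rewrite -dotNr -dotDr normr_dot_le.
  have h1 x y : ball_gauge c x - ball_gauge c y <= (enorm c + 1 + enorm c) * enorm
    (x - y).
    rewrite !gE; have := hypot_dist (dot c x) (dot c y) (enorm_ge0 x) (enorm_ge0 y).
    have := dc x y; have := enorm_dist x y.
    have := ler_norm (- (dot c x - dot c y)); rewrite normrN.
    by lra.
  apply: (@le_trans _ _ ((enorm c + 1 + enorm c) * enorm (u - v))).
    have h2 := h1 v u; have h3 := h1 u v.
    have e : enorm (v - u) = enorm (u - v) by rewrite -enormN opprB.
    rewrite {}e in h2; move: h2 h3.
    move: (ball_gauge c u) (ball_gauge c v) (_ * _) => x y D h2 h3.
    by rewrite ler_norml; apply/andP; split; lra.
  rewrite mulrAC [leRHS]mulrC ler_wpM2l ?enorm_le_norm// ?addr_ge0 ?enorm_ge0//.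
(* Chosen so that 1 - 2k = 2k|c|. After squaring k|z| + c.z, the claim reduces to k^2 + 2k|c| <= 1,
   which becomes k(2 - k) >= 0. *)
- pose k := (2 * (enorm c + 1))^-1.
  have c0 := enorm_ge0 c.
  have k0 : 0 < k by rewrite invr_gt0; lra.
  have kc : 2 * k * (enorm c + 1) = 1 by rewrite mulrAC /k mulfV// gt_eqF//; lra.
  exists k => // z; rewrite (@le_trans _ _ (k * enorm z))//.
    by rewrite ler_wpM2l ?(ltW k0)// norm_le_enorm.
  rewrite gE lerBrDr.
  have [l0|l0] := leP 0 (k * enorm z + dot c z); last first.
    by rewrite (le_trans (ltW l0))// sqrtr_ge0.
  rewrite -(ler_pXn2r (n := 2))// ?nnegrE ?sqrtr_ge0//.
  rewrite sqr_sqrtr ?addr_ge0 ?sqr_ge0//.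
  have := dot_le_enorm c z; have := enorm_ge0 z;
    move: (enorm z) (dot c z) l0 => q l _ q0 lq.
  have k2 : k <= 2^-1.
    by rewrite /k invfM ler_piMr// invf_le1; lra.
  have h1 : 2 * k * (q * l) <= (1 - 2 * k) * q ^+ 2.
    have ql : q * l <= enorm c * q ^+ 2.
      by rewrite expr2 mulrA [leRHS]mulrC ler_wpM2l.
    have -> : 1 - 2 * k = 2 * k * enorm c by move: kc; lra.
    by have := ler_wpM2l (ltW k0) ql; lra.
  have h2 : 0 <= k * (2 - k) * q ^+ 2.
    by rewrite !mulr_ge0// ?sqr_ge0 ?(ltW k0)//; lra.
  lra.
- move=> t z t0; rewrite /ball_gauge dotZr dotZl dotZr mulrBr.
  congr (_ - _); rewrite exprMn mulrA -expr2 -mulrDr sqrtrM ?sqr_ge0//.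
  by rewrite sqrtr_sqr ger0_norm.
Qed.

(** The gauge is the nonnegative root of r^2 + 2 r (c.z) - |z|^2, viewed as a quadratic in r. *)
Lemma ball_gauge_lt c z (r : R) : 0 < r ->
  (ball_gauge c z < r) = (dot z z - 2 * r * dot c z < r ^+ 2).
Proof.
move=> r0; rewrite /ball_gauge ltrBlDr; have q0 := dot_ge0 z.
move: (dot c z) (dot z z) q0 => l q q0.
have S0 := sqrtr_ge0 (l ^+ 2 + q).
have SS : Num.sqrt (l ^+ 2 + q) ^+ 2 = l ^+ 2 + q
  by rewrite sqr_sqrtr// addr_ge0// sqr_ge0.
move: (Num.sqrt _) S0 SS => S S0 SS.
apply/idP/idP => h.
  have : S ^+ 2 < (r + l) ^+ 2 by rewrite ltr_pXn2r// nnegrE; lra.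
  by rewrite SS sqrrD; lra.
rewrite ltNge; apply/negP => rlS.
have [rl|rl] := leP 0 (r + l).
  have : (r + l) ^+ 2 <= S ^+ 2 by rewrite ler_pXn2r// nnegrE.
  by rewrite SS sqrrD; lra.
(* If r + l < 0, the hypothesis would give 0 <= q < r (r + 2 l) < 0. *)
nra.
Qed.

(** For q > 0 the function sqrt(l^2 + q) - l is strictly decreasing in l. This makes the set where
    one gauge exceeds the other an open half-space. *)
Lemma ball_gauge_mono c c' z : z != 0 -> dot c z < dot c' z ->
  ball_gauge c' z < ball_gauge c z.
Proof.
move=> z0; rewrite /ball_gauge.
have q0 : 0 < dot z z by rewrite -enorm_sqr exprn_gt0//
  lt_def enorm_eq0 z0 enorm_ge0.
move: (dot c z) (dot c' z) (dot z z) q0 => l l' q q0 ll'.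
have SS x : Num.sqrt (x ^+ 2 + q) ^+ 2 = x ^+ 2 + q.
  by rewrite sqr_sqrtr// addr_ge0 ?sqr_ge0 ?(ltW q0).
have S0 := sqrtr_ge0 (l ^+ 2 + q); have S0' := sqrtr_ge0 (l' ^+ 2 + q).
have lS : l < Num.sqrt (l ^+ 2 + q).
  rewrite (le_lt_trans (ler_norm _))// -sqrtr_sqr ltr_sqrt ?ltrDl//.
  by rewrite ltr_wpDl ?sqr_ge0.
suff : Num.sqrt (l' ^+ 2 + q) < Num.sqrt (l ^+ 2 + q) + (l' - l) by lra.
have := SS l; have := SS l'; move: S0 S0' lS.
move: (Num.sqrt (l' ^+ 2 + q)) (Num.sqrt (l ^+ 2 + q)) => S' S S0 S0' lS SS' SSl.
rewrite -(ltr_pXn2r (n := 2))// ?nnegrE//; last by lra.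
by rewrite SS' sqrrD SSl; nra.
Qed.

Lemma ball_gauge_differentiable c z : z != 0 -> differentiable (ball_gauge c) z.
Proof.
move=> z0.
have dd u x : differentiable (dot u : 'rV[R]_n -> R) x.
  have -> : dot u = \sum_(i < n) (fun y : 'rV[R]_n => u ord0 i * y ord0 i).
    by apply/funext => y; rewrite fct_sumE.
  apply: differentiable_sum => i.
  apply: (@differentiableZ _ _ _ (fun y : 'rV[R]_n => y ord0 i : R^o)).
  exact: differentiable_coord.
have dz : differentiable (fun x : 'rV[R]_n => dot x x) z.
  have -> : (fun x : 'rV[R]_n => dot x x) = \sum_(i < n) (fun y :
    'rV[R]_n => y ord0 i * y ord0 i).
    by apply/funext => y; rewrite fct_sumE.
  apply: differentiable_sum => i.
  by apply: differentiableM; exact: differentiable_coord.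
have dq : differentiable (fun x : 'rV[R]_n => dot c x ^+ 2 + dot x x) z.
  apply: (@differentiableD _ _ _ (fun x : 'rV[R]_n => dot c x ^+ 2)) => //.
  rewrite (_ : (fun _ => _) = fun x : 'rV[R]_n => dot c x * dot c x); last first.
    by apply/funext => x; rewrite expr2.
  by apply: differentiableM; exact: dd.
apply: (@differentiableB _ _ _ (fun x => Num.sqrt (dot c x ^+ 2 + dot x x))) => //.
apply: (@differentiable_comp _ _ _ _ (fun x => dot c x ^+ 2 + dot x x) Num.sqrt) =>
  //.
apply/derivable1_diffP; apply: (@ex_derive _ _ _ _ _ _ _ (is_derive1_sqrt _)).
by rewrite ltr_wpDl ?sqr_ge0// -enorm_sqr exprn_gt0// lt_def enorm_eq0 z0 enorm_ge0.
Qed.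

End ball_gauge_theory.

Section chain_of_balls.
Context {R : realType} (n : nat).
Implicit Types (x y z p : 'rV[R]_n).

Lemma enorm_distC x y : enorm (x - y) = enorm (y - x).
Proof. by rewrite -enormN opprB. Qed.

Lemma enorm_lt_sqr x (r : R) : 0 < r -> (enorm x < r) = (dot x x < r ^+ 2).
Proof. by move=> r0; rewrite -enorm_sqr ltr_pXn2r// nnegrE ?enorm_ge0// ltW. Qed.

Lemma dotBB x y : dot (x - y) (x - y) = dot x x - 2 * dot x y + dot y y.
Proof. by rewrite !(dotDl, dotDr, dotNl, dotNr) (dotC y x); ring. Qed.

(* The point [p] of the line of centres on the radical hyperplane; its common
   power is [- h ^+ 2], where [h] is the radius of the sphere in which the two
   boundary spheres meet. *)
Lemma radical_point (xA xB : 'rV[R]_n) (rA rB : R) : 0 < rA -> 0 < rB ->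
  `|rB - rA| < enorm (xB - xA) < rA + rB ->
  exists p (h : R), [/\ 0 < h, dot (xA - p) (xA - p) = rA ^+ 2 - h ^+ 2 &
    dot (xB - p) (xB - p) = rB ^+ 2 - h ^+ 2].
Proof.
move=> A0 B0 /andP[d1 d2]; set d := enorm (xB - xA) in d1 d2.
have d0 : 0 < d := le_lt_trans (normr_ge0 _) d1.
(* The signed distance from [xA] to the radical hyperplane along the line of centres; the crossing
   condition amounts to |s| < rA, whence h^2 = rA^2 - s^2 > 0. *)
pose s := (d ^+ 2 + rA ^+ 2 - rB ^+ 2) / (2 * d).
have sd : 2 * d * s = d ^+ 2 + rA ^+ 2 - rB ^+ 2
  by rewrite mulrC divfK// gt_eqF ?mulr_gt0.
have [d3 d4] : rB - rA < d /\ rA - rB < d.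
  by move: d1; rewrite ltr_norml => /andP[? ?]; split; lra.
have s1 : s < rA.
  rewrite ltr_pdivrMr ?mulr_gt0//.
  have : (d - rA) ^+ 2 < rB ^+ 2 by nra.
  by lra.
have s2 : - rA < s.
  rewrite ltr_pdivlMr ?mulr_gt0//.
  have : rB ^+ 2 < (d + rA) ^+ 2 by nra.
  by lra.
have h0 : 0 < rA ^+ 2 - s ^+ 2 by nra.
pose e := d^-1 *: (xB - xA).
have ee : dot e e = 1.
  by rewrite dotZl dotZr -enorm_sqr -/d; field; rewrite gt_eqF.
exists (xA + s *: e), (Num.sqrt (rA ^+ 2 - s ^+ 2)).
rewrite sqrtr_gt0 h0 sqr_sqrtr ?(ltW h0)//; split => //.
  have -> : xA - (xA + s *: e) = - s *: e
    by rewrite opprD addrA subrr add0r scaleNr.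
  by rewrite dotZl dotZr ee; ring.
have -> : xB - (xA + s *: e) = (d - s) *: e.
  rewrite opprD addrA scalerBl; congr (_ - _).
  by rewrite /e scalerA mulfV ?scale1r// gt_eqF.
by rewrite dotZl dotZr ee; move: sd; rewrite mulr1; nra.
Qed.

(** In the coordinate y = p + h z, the set {gauge < t} is the dilate by t about p of the ball:
    centre p + t (x - p), radius t r. *)
Lemma eball_ball_gauge x p z (r h t : R) : 0 < h -> 0 < t ->
  dot (x - p) (x - p) = r ^+ 2 - h ^+ 2 ->
  (ball_gauge (h^-1 *: (x - p)) z < t) =
  (dot (h *: z - t *: (x - p)) (h *: z - t *: (x - p)) < (t * r) ^+ 2).
Proof.
move=> h0 t0 xp; rewrite ball_gauge_lt// dotBB !dotZl !dotZr xp (dotC z).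
rewrite -(ltr_pM2l (exprn_gt0 2 h0)).
have -> : h ^+ 2 * (dot z z - 2 * t * (h^-1 * dot (x - p) z)) =
    h ^+ 2 * dot z z - 2 * (h * (t * dot (x - p) z)).
  by field; rewrite gt_eqF.
move: (dot z z) (dot (x - p) z) => q l.
by apply/idP/idP; lra.
Qed.

(** The stretching is conjugated by [T], which carries the origin to the radical point and the unit
    of length to [h], making both powers -1. *)
Lemma attach_ball (xA xB : 'rV[R]_n) (rA rB e : R) : 0 < rA -> 0 < rB ->
  `|rB - rA| < enorm (xB - xA) < rA + rB -> 0 < e ->
  exists F : 'rV[R]_n -> 'rV[R]_n, [/\ bilip_qc F,
    F @` eball xA rA = eball xA rA `|` eball xB rB &
    forall y, rB + e <= enorm (y - xB) -> F y = y].
Proof.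
move=> A0 B0 AB e0; have [p [h [h0 pA pB]]] := radical_point A0 B0 AB.
pose cA := h^-1 *: (xA - p); pose cB := h^-1 *: (xB - p).
pose T z := p + h *: z; pose T' y := (- (h^-1 *: p)) + h^-1 *: y.
have TK : cancel T T'.
  move=> z; rewrite /T /T' scalerDr addrA addNr add0r scalerA mulVf ?scale1r//.
  by rewrite gt_eqF.
have T'K : cancel T' T.
  move=> y; rewrite /T /T' scalerDr scalerN !scalerA mulfV ?gt_eqF// !scale1r.
  by rewrite addrA subrr add0r.
have TE x z : T z - x = h *: z - (x - p) by rewrite /T opprB [p + _]addrC addrA.
have inA z : (ball_gauge cA z < 1) = (enorm (T z - xA) < rA).
  by rewrite (eball_ball_gauge _ h0 ltr01 pA) enorm_lt_sqr// TE scale1r mul1r.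
have inB z : (ball_gauge cB z < 1) = (enorm (T z - xB) < rB).
  by rewrite (eball_ball_gauge _ h0 ltr01 pB) enorm_lt_sqr// TE scale1r mul1r.
have gA := ball_gauge_like cA; have gB := ball_gauge_like cB.
pose D := enorm (xB - p); have D0 : 0 <= D := enorm_ge0 _.
(* The dilate of B by 1 + t about p lies within rB + t (rB + D) = rB + e of [xB]; [d] below
   satisfies 1/(1 - d) = 1 + t, so moved points lie in this dilate. *)
pose t := e / (rB + D); have t0 : 0 < t by rewrite divr_gt0//; lra.
have t1 : 0 < 1 + t by lra.
pose d := t / (1 + t).
have d01 : 0 < d < 1 by rewrite divr_gt0//= ltr_pdivrMr// mul1r; lra.
have d1t : 1 - d = (1 + t)^-1 by rewrite /d; field; rewrite gt_eqF.
pose S := gauge_stretch d (ball_gauge cA) (ball_gauge cB).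
have wE z : dot (cB - cA) z = dot cB z - dot cA z by rewrite dotDl dotNl.
have bS : bilip_qc S.
  apply: (gauge_stretch_bilip_qc (w := cB - cA) gA gB) => //.
  - exact: ball_gauge_differentiable.
  - exact: ball_gauge_differentiable.
  - rewrite /cA /cB -scalerBr opprB addrA subrK scaler_eq0 invr_eq0 gt_eqF//=.
    rewrite -enorm_eq0 gt_eqF//; case/andP: AB => + _; exact: le_lt_trans.
  - move=> z; rewrite wE => wz; have [->|z0] := eqVneq z 0.
      by rewrite !gauge_like0.
    have : dot cB z <= dot cA z by lra.
    rewrite le_eqVlt => /orP[/eqP e1|/(ball_gauge_mono z0)/ltW//].
    by rewrite /ball_gauge e1.
  - move=> z; rewrite wE => wz; apply: ball_gauge_mono; last by lra.
    apply: contraTneq wz => ->.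
    by rewrite -(scale0r (0 : 'rV[R]_n)) !dotZr !mul0r subrr ltxx.
exists (T \o (S \o T')); split.
- apply: bilip_qc_comp; last exact: bilip_qc_affine.
  by apply: bilip_qc_comp bS; apply: bilip_qc_affine; rewrite invr_gt0.
- apply/seteqP; split => [_ [y yA <-]|y yAB] /=.
    have : (ball_gauge cA (S (T' y)) < 1) || (ball_gauge cB (S (T' y)) < 1).
      by rewrite gauge_stretch_inside// inA T'K.
    by rewrite inA inB => /orP[?|?]; [left|right].
  exists (T (gauge_shrink d (ball_gauge cA) (ball_gauge cB) (T' y))); last first.
    by rewrite /= TK /S gauge_shrinkK// T'K.
  rewrite /eball/= -inA -(gauge_stretch_inside _ gA gB d01) gauge_shrinkK//.
  by rewrite inA inB T'K; apply/orP; case: yAB => ?; [left|right].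
- move=> y; apply: contraPP => /eqP Fy; apply/negP; rewrite -ltNge.
  have Sy : S (T' y) != T' y.
    by apply: contra Fy => /eqP Sy; rewrite /= Sy T'K.
  have := gauge_stretch_moved gB d01 Sy.
  rewrite d1t mulrC ltr_pdivrMr// mul1r (eball_ball_gauge _ h0 t1 pB).
  rewrite -enorm_lt_sqr ?mulr_gt0// => hy.
  have -> : y - xB = (h *: T' y - (1 + t) *: (xB - p)) + t *: (xB - p).
    by rewrite scalerDl scale1r opprD addrA subrK -TE T'K.
  rewrite (le_lt_trans (enormD _ _))// enormZ (gtr0_norm t0) -/D.
  have : t * (rB + D) = e by rewrite /t divfK// gt_eqF//; lra.
  by lra.
Qed.

Lemma closure_eball x z (r : R) :
  0 < r -> enorm (z - x) <= r -> closure (eball x r) z.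
Proof.
move=> r0 zr U /nbhs_ballP[e /= e0 eU].
pose s := Num.min 1 (e / (2 * (`|z - x| + 1))).
have N0 : 0 < `|z - x| + 1 by rewrite ltr_wpDl.
have s0 : 0 < s by rewrite lt_min ltr01 divr_gt0// mulr_gt0.
have s1 : s <= 1 by rewrite ge_min lexx.
have se : s * `|z - x| < e.
  have : s <= e / (2 * (`|z - x| + 1)) by rewrite ge_min lexx orbT.
  rewrite ler_pdivlMr ?mulr_gt0// => h.
  have := normr_ge0 (z - x); nra.
exists (z - s *: (z - x)); split.
  have -> : z - s *: (z - x) = x + (1 - s) *: (z - x).
    by rewrite scalerBl scale1r addrA [x + _]addrC subrK.
  rewrite /eball/= addrC addKr enormZ ger0_norm ?subr_ge0//.
  have [->|n0] := eqVneq (enorm (z - x)) 0; first by rewrite mulr0.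
  rewrite (lt_le_trans _ zr)// gtr_pMl; first by rewrite gtrBl.
  by rewrite lt_def n0 enorm_ge0.
apply: eU; rewrite mx_norm_ball /ball_ /= opprB addrC subrK normrZ gtr0_norm//.
Qed.

(** Otherwise the point dividing the segment of centres in the ratio r : q would lie in both closed
    balls. *)
Lemma disjoint_closure_eball x y (r q : R) : 0 < r -> 0 < q ->
  closure (eball x r) `&` closure (eball y q) = set0 -> r + q < enorm (x - y).
Proof.
move=> r0 q0 xy; rewrite ltNge; apply/negP => h.
have rq : 0 < r + q by rewrite addr_gt0.
pose z := x + (r / (r + q)) *: (y - x).
have : (closure (eball x r) `&` closure (eball y q)) z; last by rewrite xy.
have rr : 0 <= r / (r + q) by rewrite divr_ge0// ltW.
split; apply: closure_eball => //.
  rewrite /z addrC addKr enormZ ger0_norm// enorm_distC.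
  by rewrite mulrAC ler_pdivrMr// ler_wpM2l// ltW.
have -> : z - y = (q / (r + q)) *: (x - y).
  have -> : q / (r + q) = 1 - r / (r + q) by field; rewrite gt_eqF.
  by rewrite /z -(opprB x y) scalerN scalerBl scale1r addrAC.
rewrite enormZ ger0_norm; last by rewrite divr_ge0// ltW.
by rewrite mulrAC ler_pdivrMr// ler_wpM2l// ltW.
Qed.

End chain_of_balls.

Lemma finite_pos_lower_bound {R : realType} (I : finType) (P : pred I) (f :
  I -> R) :
  (forall j, P j -> 0 < f j) -> exists2 e, 0 < e & forall j, P j -> e <= f j.
Proof.
move=> f0; exists (\big[Num.min/1]_(j | P j) f j).
  by apply: lt_bigmin.
by move=> j Pj; exact: bigmin_le_cond.
Qed.

Theorem theorem4p1 (R : realType) (n m : nat) (hn : (2 <= n)%N) (hm : (1 <= m)%N)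
    (x : 'I_m -> 'rV[R]_n) (r : 'I_m -> R)
    (r_gt0 : forall j : 'I_m, 0 < r j)
    (adjacent : forall j k : 'I_m, k = j.+1 :> nat ->
      `|r k - r j| < enorm (x k - x j) < r j + r k)
    (disjoint : forall j k : 'I_m, (j.+1 < k)%N \/ (k.+1 < j)%N ->
      closure (eball (x j) (r j)) `&` closure (eball (x k) (r k)) = set0) :
  quasiball (Some @` (\bigcup_(j in [set: 'I_m]) eball (x j) (r j))).
Proof.
(* Indices start at 0, so [D k] contains k + 1 balls and the whole union is [D m.-1]. *)
pose D k := \bigcup_(j in [set j : 'I_m | (j <= k)%N]) eball (x j) (r j).
suff chain k : (k < m)%N -> exists2 F, bilip_qc F & F @` eball 0 1 = D k.
  have [|F qF FD] := chain m.-1; first by rewrite prednK.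
  have -> : \bigcup_(j in [set: 'I_m]) eball (x j) (r j) = F @` eball 0 1.
    rewrite FD; apply: eq_bigcupl; split => j //= _.
    by rewrite -ltnS prednK.
  by apply: bilip_qc_quasiball qF; apply: leq_trans hn.
elim: k => [m0|k IH km].
  pose j0 := Ordinal m0; exists (fun y => x j0 + r j0 *: y).
    exact: bilip_qc_affine.
  have -> : D 0%N = eball (x j0) (r j0).
    apply/seteqP; split => [y [j /=]|y yj0]; last by exists j0.
    by rewrite leqn0 => /eqP j00; have -> : j = j0 by exact/val_inj.
  have r0 := r_gt0 j0; apply/seteqP; split => [_ [y y1 <-]|y yj0].
    move: y1; rewrite /eball/= subr0 addrC addKr enormZ gtr0_norm// => y1.
    by rewrite gtr_pMr.
  exists ((r j0)^-1 *: (y - x j0)); last first.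
    by rewrite scalerA mulfV ?gt_eqF// scale1r addrC subrK.
  by rewrite /eball/= subr0 enormZ gtr0_norm ?invr_gt0// ltr_pdivrMl// mulr1.
have [F qF FD] := IH (ltnW km).
pose jA := Ordinal (ltnW km); pose jB := Ordinal km.
(* A uniform gap between the new ball and all balls before its predecessor; it is positive because
   only finitely many disjoint closed balls are involved. *)
have [e e0 gap] : exists2 e, 0 < e & forall j : 'I_m, (j < k)%N ->
    e <= enorm (x j - x jB) - (r j + r jB).
  apply: finite_pos_lower_bound => j jk; rewrite subr_gt0.
  apply: disjoint_closure_eball => //; apply: disjoint; left.
  by rewrite /= ltnS.
have [G [qG GA Gid]] := attach_ball (r_gt0 jA) (r_gt0 jB) (adjacent jA jB erefl) e0.
exists (G \o F); first exact: bilip_qc_comp.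
(* By the triangle inequality, a point of an earlier ball is at distance at least r_B + e from the
   new centre. *)
have Gfix (j : 'I_m) y : (j < k)%N -> eball (x j) (r j) y -> G y = y.
  move=> jk yj; apply: Gid; have := gap j jk; have := enormD (x j - y) (y - x jB).
  rewrite addrA subrK (enorm_distC (x j)).
  by move: yj; rewrite /eball/=; lra.
rewrite -image_comp FD; apply/seteqP;
  split => [_ [y [j /= jk yj] <-]|y [j /= jk yj]].
  move: jk; rewrite leq_eqVlt => /orP[/eqP jk|jk]; last first.
    by rewrite (Gfix j)//; exists j => //=; rewrite ltnW// ltnW.
  have jE : j = jA by exact/val_inj.
  have : (G @` eball (x jA) (r jA)) (G y) by exists y => //; rewrite -jE.
  by rewrite GA => -[yA|yB]; [exists jA => //=; rewrite leqnSn|exists jB => /=].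
have [jk1|jk1] := ltnP j k.
  by exists y; [exists j => //=; rewrite ltnW|exact: (Gfix j)].
have : (G @` eball (x jA) (r jA)) y.
  rewrite GA; move: jk; rewrite leq_eqVlt => /orP[/eqP jk|jk].
    by right; have <- : j = jB by exact/val_inj.
  left; have <- // : j = jA.
  by apply/val_inj/eqP; rewrite /= eqn_leq jk1 andbT.
by move=> [z zA <-]; exists z => //; exists jA => /=.
Qed.
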